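(* Assume that $\mathbf{E}\ln\rho_0<0$ and that there exists a unique $\kappa>0$ such that $\mathbf{E}[\rho_0^{\kappa}]=1$ and $\mathbf{E}[\rho_0^{\kappa}\ln^+\rho_0]<\infty$. Then (a) $\displaystyle\lim_{n\to\infty}\frac{\ln E_\omega(T_n)}{\ln n}=\max\left\{\frac1\kappa,1\right\}$ $\mathbf{P}$-a.s., (b) $\displaystyle\lim_{n\to\infty}\frac{\ln \mathrm{Var}_\omega(T_n)}{\ln n}=\max\left\{\frac2\kappa,1\right\}$ $\mathbf{P}$-a.s.
   Context: Environment: $\omega=(\omega_k)_{k\in\mathbb{Z}}$ is a family of i.i.d. random variables with values in $(0,1)$; $\mathbf{P}$ is its law, $\mathbf{E}$ the corresponding expectation, and $\rho_i:=(1-\omega_i)/\omega_i$. Random walk in random environment: under the quenched law $P_\omega$, $(X_k)_{k\in\mathbb{N}_0}$ is the Markov chain on $\mathbb{Z}$ with $X_0=0$ which jumps from $i$ to $i+1$ with probability $\omega_i$ and from $i$ to $i-1$ with probability $1-\omega_i$. $E_\omega$, $\mathrm{Var}_\omega$ denote expectation and variance under $P_\omega$, and $T_n:=\min\{l\in\mathbb{N}_0:X_l=n\}$. *)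

(* Defs.v *)
From HB Require Import structures.
From mathcomp Require Import all_boot all_order all_algebra.
From mathcomp Require Import all_classical all_reals all_analysis.

Set Implicit Arguments.
Unset Strict Implicit.
Unset Printing Implicit Defensive.

Import Order.TTheory GRing.Theory Num.Theory.
Import numFieldNormedType.Exports.

Local Open Scope classical_set_scope.
Local Open Scope ring_scope.

Definition mutually_independent (d : measure_display) (T : measurableType d)
    (R : realType) (P : probability T R) (I : choiceType)
    (Y : I -> {RV P >-> R}) : Prop :=
  forall (s : seq I) (A : I -> set R), uniq s ->
    (forall i, measurable (A i)) ->
    P (\bigcap_(i in [set` s]) (Y i @^-1` A i)) =
    (\prod_(i <- s) P (Y i @^-1` A i))%E.

Definition identically_distributed (d : measure_display)
    (T : measurableType d) (R : realType) (P : probability T R)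
    (I : choiceType) (Y : I -> {RV P >-> R}) : Prop :=
  forall (i j : I) (A : set R), measurable A ->
    distribution P (Y i) A = distribution P (Y j) A.

Definition iid (d : measure_display) (T : measurableType d) (R : realType)
    (P : probability T R) (I : choiceType) (Y : I -> {RV P >-> R}) : Prop :=
  mutually_independent Y /\ identically_distributed Y.

Definition rho (R : realType) (e : int -> R) (i : int) : R := (1 - e i) / e i.

Definition transition (R : realType) (e : int -> R) (i j : int) : R :=
  if j == i + 1 then e i else if j == i - 1 then 1 - e i else 0.

(* Under Q, the process X is the Markov chain on int started at 0 with
   transition probabilities [transition e].  The Markov property
   Q(X_{n+1} = x_{n+1} | X_0 = x_0, ..., X_n = x_n) = p(x_n, x_{n+1})
   is stated in product form, so that no conditioning event of probability 0
   has to be excluded.  As int carries the discrete sigma-algebra,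
   measurability of X_k is that of the preimages of the singletons. *)
Definition walk_in_environment (d : measure_display) (T : measurableType d)
    (R : realType) (Q : probability T R) (X : nat -> T -> int)
    (e : int -> R) : Prop :=
  [/\ forall (k : nat) (i : int), measurable (X k @^-1` [set i]),
      Q (X 0%N @^-1` [set 0]) = 1%E
    & forall (n : nat) (x : nat -> int),
        Q [set t | forall k, (k <= n.+1)%N -> X k t = x k] =
        (Q [set t | forall k, (k <= n)%N -> X k t = x k] *
         (transition e (x n) (x n.+1))%:E)%E].

(* The infimum of the empty set is +oo: a level that is never reached has
   hitting time +oo. *)
Definition hitting_time (R : realType) (T : Type) (X : nat -> T -> int)
    (n : nat) (t : T) : \bar R :=
  ereal_inf [set l%:R%:E | l in [set l : nat | X l t = n%:Z]].

(* The library's expectation and variance only take real-valued random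
   variables; these are their counterparts for a [0, +oo]-valued one. *)
Definition expectatione (d : measure_display) (T : measurableType d)
    (R : realType) (Q : probability T R) (Y : T -> \bar R) : \bar R :=
  (\int[Q]_t Y t)%E.

Definition variancee (d : measure_display) (T : measurableType d)
    (R : realType) (Q : probability T R) (Y : T -> \bar R) : \bar R :=
  expectatione Q (fun t => ((Y t - expectatione Q Y) ^+ 2)%E).

Definition kappa_condition (d : measure_display) (T : measurableType d)
    (R : realType) (P : probability T R) (r : T -> R) (kappa : R) : Prop :=
  [/\ 0 < kappa,
      ('E_P[fun w => (r w `^ kappa)%R] = 1)%E
    & ('E_P[fun w => (r w `^ kappa * Num.max (ln (r w)) 0)%R] < +oo)%E].

(* Main.v *)
(* The walk moves to the right one level at a time, so E_omega(T_n) and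
   Var_omega(T_n) are the sums over k < n of the mean a_k and the variance b_k
   of the time spent between the first visits to k and k + 1. Conditioning on
   the first step gives a_k = 1 + rho_k + rho_k a_{k-1} and
   b_k = rho_k b_{k-1} + rho_k (1 + rho_k) (1 + a_{k-1})^2. For an environment
   reflected far to the left these recursions are finite, and a supermartingale
   argument identifies the moments of T_n with their monotone limits.

   Upper bounds: E[rho^s] < 1 for 0 < s < kappa, so for s <= 1, by
   subadditivity of x^s, the s-th moments of a_k are bounded when s < kappa, and
   those of b_k when 2s < kappa. Markov's inequality along dyadic n bounds the
   sums by n^(1/s + o(1)).

   Lower bounds: a_k >= 1, b_k >= rho_k, and for every block of consecutive
   sites ending at k whose product of rho's is p, a_k >= p and b_k >= p^2.
   Since E[rho^s] > 1 for s > kappa, for every gamma > kappa some m and y > 1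
   satisfy P(rho_1 ... rho_m > y) >= y^(-gamma). Concatenating N such blocks,
   products larger than y^N have probability at least y^(-gamma N), so they
   occur among the first y^((gamma + o(1)) N) sites. *)
Require Import Defs.
From HB Require Import structures.
From mathcomp Require Import all_boot all_order all_algebra.
From mathcomp Require Import all_classical all_reals all_analysis.
From mathcomp Require Import measurable_realfun ring lra zify.

Set Implicit Arguments.
Unset Strict Implicit.
Unset Printing Implicit Defensive.

Import Order.TTheory GRing.Theory Num.Theory.
Import numFieldNormedType.Exports.

Local Open Scope classical_set_scope.
Local Open Scope ring_scope.

(** * Independence of disjoint sets of sites *)

Section independence.
Context d (T : measurableType d) (R : realType) (P : probability T R).

(** The walk is given through the laws of its finite paths, and [T_n] may be infinite a priori. Its
    moments are therefore read off from tails: [P(T_n > t)] is an iterate of a one-step operator on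
    the distances to [n], and [E T = sum_t P(T > t)], [E T^2 = sum_t (2t+1) P(T > t)]. The sums of
    crossing moments are candidate values that are squeezed against these series, which also yields
    finiteness of the moments. The almost sure bounds share one device, which plays the part of
    Borel-Cantelli: weights are chosen so that a nondecreasing sequence of nonnegative variables has
    bounded means; its limit is then finite almost surely and bounds every weighted term.
    Independence is used through disjoint sets of sites: a crossing moment at [x - 1] depends on
    sites up to [x - 1] only, hence is independent of [rho_x]. Subadditivity restricts the moments
    to orders at most 1, whence the maximum with 1 in both exponents. It is attained from below by
    [a_k >= 1] for the mean and by the linear growth of the sums of [rho_k] for the variance. *)

Lemma dynkin_indep (B : set T) : measurable B ->
  dynkin [set A | measurable A /\ P (A `&` B) = (P A * P B)%E].
Proof.
move=> mB; split => /=.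
- by split; [exact: measurableT | rewrite setTI probability_setT mul1e].
- move=> A [mA AB]; split; first exact: measurableC.
  have -> : ~` A `&` B = B `\` A by rewrite setIC setDE.
  rewrite measureD//; last by rewrite ltey_eq fin_num_measure.
  rewrite (setIC B) [X in (_ - X)%E]AB probability_setC// muleBl ?mul1e//.
    by rewrite fin_num_measure.
- move=> F tF FB; split; first by apply: bigcup_measurable => k _; have [] := FB k.
  have mF k : measurable (F k) by have [] := FB k.
  rewrite setI_bigcupl !measure_bigcup//; last 2 first.
    by move=> k _; exact: measurableI.
    by under eq_fun do rewrite setIC; exact: trivIset_setIl.
  have PBE : P B = (fine (P B))%:E by rewrite fineK// fin_num_measure.
  rewrite [X in (_ * X)%E]PBE muleC -nneseriesZl; last by move=> k _; exact: measure_ge0.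
  apply: eq_eseriesr => k _; have [_ H] := FB k; rewrite -PBE muleC; exact: H.
Qed.

Context (I : choiceType) (Y : I -> {RV P >-> R}).

(** Cylinder events over finitely many sites of [S]: a pi-system generating the sigma-algebra of the
    coordinates in [S]. *)
Definition rect (S : set I) : set (set T) :=
  [set B | exists (s : seq I) (A : I -> set R),
    [/\ uniq s, (forall i, i \in s -> S i), (forall i, measurable (A i)) &
      B = \bigcap_(i in [set` s]) (Y i @^-1` A i)]].

Lemma rect_measurable S : rect S `<=` measurable.
Proof.
move=> _ [s [A [us sS mA ->]]]; apply: fin_bigcap_measurable => //.
by move=> i _; rewrite -[X in measurable X]setTI; exact: measurable_funP.
Qed.

Lemma rect_setI S : setI_closed (rect S).
Proof.
move=> _ _ [s [A [us sS mA ->]]] [t [B [ut tS mB ->]]].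
exists (undup (s ++ t)), (fun i => (if i \in s then A i else setT) `&`
  (if i \in t then B i else setT)); split.
- exact: undup_uniq.
- by move=> i; rewrite mem_undup mem_cat => /orP[/sS|/tS].
- by move=> i; apply: measurableI; case: ifP.
- apply/seteqP; split=> [w [As Bt] i /=|w H].
    by move=> _; split; case: ifPn => // ii; [exact: As|exact: Bt].
  split=> i /= ii; have := H i; rewrite /= mem_undup mem_cat ii ?orbT;
    by case/(_ isT).
Qed.

Lemma sigma_rect_measurable S : <<s rect S >> `<=` measurable.
Proof. by apply: smallest_sub; [exact: sigma_algebra_measurable|exact: rect_measurable]. Qed.

(** Dynkin's pi-lambda theorem, once in each argument: with a cylinder over [S] fixed, the other
    event is extended from cylinders to [<<s rect S' >>]; that event is then fixed and the cylinder
    extended. *)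
Lemma indep_sigma_rect S S' A B : mutually_independent Y -> S `&` S' = set0 ->
  <<s rect S >> A -> <<s rect S' >> B -> P (A `&` B) = (P A * P B)%E.
Proof.
move=> indY SS'.
have key C : rect S C -> forall D, <<s rect S' >> D -> P (D `&` C) = (P D * P C)%E.
  move=> rC; rewrite -setI_closed_g_dynkin_g_sigma_algebra; last exact: rect_setI.
  suff : <<d rect S' >> `<=`
      [set D | measurable D /\ P (D `&` C) = (P D * P C)%E].
    by move=> + D rD => /(_ _ rD)[].
  apply: smallest_sub; first exact/dynkin_indep/(rect_measurable rC).
  move=> D rD; split; first exact: rect_measurable rD.
  case: rC => s [E [us sS mE ->]]; case: rD => t [F [ut tS' mF ->]].
  have disj i : i \in t -> i \in s -> False.
    by move=> /tS' Si /sS Si'; move/seteqP : SS' => [/(_ i) + _]; apply.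
  have -> : \bigcap_(i in [set` t]) Y i @^-1` F i `&`
      \bigcap_(i in [set` s]) Y i @^-1` E i =
      \bigcap_(i in [set` t ++ s])
        Y i @^-1` (if i \in t then F i else E i).
    apply/seteqP; split=> [w [Ft Es] i /=|w H].
      by rewrite mem_cat; case: ifPn => /= [it _|it si]; [exact: Ft|exact: Es].
    split=> i /= ii; have := H i; rewrite /= mem_cat ii ?orbT => /(_ isT) //.
    by case: ifPn => // it _; have := disj _ it ii.
  rewrite !indY//; last 2 first.
    rewrite cat_uniq ut us andbT/=; apply/hasPn => i si; apply/negP => ti.
    exact: disj ti si.
    by move=> i; case: ifP.
  rewrite big_cat/=; congr (_ * _)%E; apply: eq_big_seq => i ii.
    by rewrite ii.
  by case: ifPn => // it; have := disj _ it ii.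
move=> + sB; rewrite -setI_closed_g_dynkin_g_sigma_algebra; last exact: rect_setI.
suff : <<d rect S >> `<=` [set A | measurable A /\ P (A `&` B) = (P A * P B)%E].
  by move=> + rA => /(_ _ rA)[].
have mB := sigma_rect_measurable sB.
apply: smallest_sub; first exact: dynkin_indep.
move=> C rC; split; first exact: rect_measurable rC.
by rewrite setIC key// muleC.
Qed.

End independence.

(** * Independent pairs: joint laws and expectations of products *)

Section independent_pair.
Context d (T : measurableType d) (R : realType) (P : probability T R).

Definition indep2 (X Y : T -> R) : Prop := forall A B : set R,
  measurable A -> measurable B ->
  P (X @^-1` A `&` Y @^-1` B) = (P (X @^-1` A) * P (Y @^-1` B))%E.

Lemma joint_law (X Y : {RV P >-> R}) (E : set (R * R)) : indep2 X Y ->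
  measurable E ->
  P [set w | E (X w, Y w)] = (distribution P X \x distribution P Y)%E E.
Proof.
move=> XY mE.
have mXY : measurable_fun setT (fun w => (X w, Y w)).
  by apply: measurable_fun_pair; exact: measurable_funP.
pose Z : {RV P >-> (R * R)%type} :=
  HB.pack (fun w => (X w, Y w)) (isMeasurableFun.Build _ _ _ _ _ mXY).
symmetry; apply: (product_measure_unique (m' := distribution P Z)) => //.
Qed.

Lemma indep2_expectationM (X Y : {RV P >-> R}) : indep2 X Y ->
  (forall w, 0 <= X w) -> (forall w, 0 <= Y w) ->
  (\int[P]_w (X w * Y w)%:E = (\int[P]_w (X w)%:E) * (\int[P]_w (Y w)%:E))%E.
Proof.
move=> XY X0 Y0.
have mXY : measurable_fun setT (fun w => (X w, Y w)).
  by apply: measurable_fun_pair; exact: measurable_funP.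
pose Z : {RV P >-> (R * R)%type} :=
  HB.pack (fun w => (X w, Y w)) (isMeasurableFun.Build _ _ _ _ _ mXY).
(* Absolute values make the integrand nonnegative on the whole plane, as Tonelli requires; they
   change nothing on the ranges of [X] and [Y]. *)
pose f (z : R * R) : \bar R := (`|z.1| * `|z.2|)%:E.
pose g (x : R) : \bar R := `|x|%:E.
have mabs : measurable_fun [set: R] g.
  by apply/measurable_EFinP; exact: normr_measurable.
have g0 x : (0 <= g x)%E by rewrite lee_fin.
have mf : measurable_fun [set: R * R] f.
  apply/measurable_EFinP/measurable_funM; apply: measurableT_comp => //.
have f0 z : (0 <= f z)%E by rewrite lee_fin mulr_ge0.
transitivity (\int[distribution P Z]_z f z)%E.
  rewrite ge0_integral_distribution//; apply: eq_integral => w _ /=.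
  by rewrite /f /= !ger0_norm.
rewrite (eq_measure_integral (distribution P X \x distribution P Y)%E); last first.
  by move=> E mE _; exact: (joint_law XY mE).
rewrite fubini_tonelli1//.
have eX : (\int[P]_w (X w)%:E = \int[distribution P X]_x g x)%E.
  rewrite ge0_integral_distribution//.
  by apply: eq_integral => w _ /=; rewrite /g ger0_norm.
have eY : (\int[P]_w (Y w)%:E = \int[distribution P Y]_x g x)%E.
  rewrite ge0_integral_distribution//.
  by apply: eq_integral => w _ /=; rewrite /g ger0_norm.
rewrite eX -ge0_integralZr//; last by apply: integral_ge0 => w _; rewrite lee_fin.
apply: eq_integral => x _; rewrite /fubini_F /f /=.
under eq_integral do rewrite EFinM.
by rewrite ge0_integralZl ?lee_fin// -eY.
Qed.

Lemma indep2_law (X Y X' Y' : {RV P >-> R}) (E : set (R * R)) :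
  indep2 X Y -> indep2 X' Y' ->
  (forall A, measurable A -> distribution P X A = distribution P X' A) ->
  (forall A, measurable A -> distribution P Y A = distribution P Y' A) ->
  measurable E ->
  P [set w | E (X w, Y w)] = P [set w | E (X' w, Y' w)].
Proof.
move=> XY XY' eX eY mE; rewrite !joint_law//.
apply: product_measure_unique => //= A B mA mB.
by rewrite product_measure1E// eX// eY.
Qed.

Context (I : choiceType) (Y : I -> {RV P >-> R}).

(** Expresses that [X] is a function of the sites in [S], in a form stable under arithmetic
    operations. *)
Definition rect_measurable_fun (S : set I) (X : T -> R) : Prop :=
  measurable_fun (setT : set (g_sigma_algebraType (rect Y S))) X.

Lemma rect_measurable_funP S X : rect_measurable_fun S X ->
  measurable_fun setT X.
Proof.
move=> mX _ A mA; rewrite setTI; apply: (@sigma_rect_measurable _ _ _ _ _ Y S).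
have := mX measurableT A mA; rewrite setTI; exact.
Qed.

Lemma rect_measurable_indep2 S S' X X' : mutually_independent Y ->
  S `&` S' = set0 -> rect_measurable_fun S X -> rect_measurable_fun S' X' ->
  indep2 X X'.
Proof.
move=> iY SS' mX mX' A B mA mB; apply: (indep_sigma_rect iY SS').
- by have := mX measurableT A mA; rewrite setTI; exact.
- by have := mX' measurableT B mB; rewrite setTI; exact.
Qed.

Lemma rect_measurable_coord (S : set I) i : S i -> rect_measurable_fun S (Y i).
Proof.
move=> Si _ A mA; rewrite setTI; apply: sub_sigma_algebra.
exists [:: i], (fun j => if j == i then A else setT); split => //.
- by move=> j; rewrite inE => /eqP ->.
- by move=> j; case: ifP.
- apply/seteqP; split=> [w Aw j /=|w H].
    by rewrite inE => /eqP ->; rewrite eqxx.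
  by have := H i; rewrite /= eqxx inE eqxx => /(_ isT).
Qed.

Lemma rect_measurable_funS S S' X : S `<=` S' -> rect_measurable_fun S X ->
  rect_measurable_fun S' X.
Proof.
move=> SS' mX _ A mA; have := mX measurableT A mA; rewrite !setTI.
apply: smallest_sub; first exact: smallest_sigma_algebra.
move=> B [s [C [us sS mC ->]]]; apply: sub_sigma_algebra.
by exists s, C; split => // i /sS /SS'.
Qed.

End independent_pair.
(** * Quenched moments of the hitting times *)

Section killed_operator.
Context (R : realType).
Implicit Types f g : nat -> R.

(** The bound by [U] makes the series converge, so [u t] tends to 0 and the error [C * u t] vanishes
    for each fixed [M]. The sum thus dominates every [V M], hence also [U]. *)
Lemma squeeze_series (u : nat -> R) (V : nat -> R) (U : R) :
  (forall s, 0 <= u s) -> (forall t, series u t <= U) ->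
  (forall M, exists C, forall t, V M <= series u t + C * u t) ->
  V @ \oo --> U -> series u @ \oo --> U.
Proof.
move=> u0 uU VC VU.
have nd : nondecreasing_seq (series u).
  by apply/nondecreasing_seqP => n; rewrite /series /= big_nat_recr//= lerDl.
have cu : cvgn (series u).
  by apply: nondecreasing_is_cvgn => //; exists U => _ [t _ <-].
suff <- : limn (series u) = U by [].
apply/eqP; rewrite eq_le; apply/andP; split.
  by apply: limr_le => //; near=> t; exact: uU.
have VL M : V M <= limn (series u).
  have [C HC] := VC M.
  have -> : limn (series u) = limn (fun t => series u t + C * u t).
    apply/esym/cvg_lim => //; rewrite -[X in _ --> X]addr0.
    apply: cvgD => //; rewrite -(mulr0 C); apply: cvgMr.
    exact: cvg_series_cvg_0.
  apply: limr_ge; last by near=> t; exact: HC.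
  apply: is_cvgD => //; apply: is_cvgMr; apply/cvg_ex; exists 0.
  exact: cvg_series_cvg_0.
have <- : limn V = U by exact: cvg_lim.
by apply: limr_le; [apply/cvg_ex; exists U | near=> M; exact: VL].
Unshelve. all: by end_near. Qed.

Variable p : nat -> R.

(* One step of the walk on the distances to the target, killed on hitting the
   target: from d > 0 it moves to d - 1 with probability p d. *)
Definition killed f : nat -> R := fun d =>
  if d is d'.+1 then p d * f d' + (1 - p d) * f d.+1 else 0.

(** At [d] this is the probability that the walk started at distance [d] has not reached its target
    by time [t]. *)
Definition survival (t : nat) : nat -> R :=
  iter t killed (fun d => (0 < d)%N%:R).

Hypothesis p01 : forall d, 0 <= p d <= 1.

Lemma killed_le f g : (forall d, f d <= g d) -> forall d, killed f d <= killed g d.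
Proof.
move=> fg [|d] //=; have /andP[p0 p1] := p01 d.+1.
by apply: lerD; rewrite ler_wpM2l// subr_ge0.
Qed.

Lemma iter_killed_le t f g : (forall d, f d <= g d) ->
  forall d, iter t killed f d <= iter t killed g d.
Proof. by move=> fg; elim: t => //= t; exact: killed_le. Qed.

Lemma iter_killedD t f g d :
  iter t killed (fun d => f d + g d) d = iter t killed f d + iter t killed g d.
Proof.
elim: t d => //= t IH [|d] /=; first by rewrite addr0.
by rewrite !IH; ring.
Qed.

Lemma iter_killedZ t c f d :
  iter t killed (fun d => c * f d) d = c * iter t killed f d.
Proof.
elim: t d => //= t IH [|d] /=; first by rewrite mulr0.
by rewrite !IH; ring.
Qed.

(** Duhamel expansion: the one-step inequality is substituted into itself [t] times, which
    monotonicity of [killed] permits. The index [s] is time, so space-time functions are covered. *)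
Lemma iter_killed_forced (h g : nat -> nat -> R) t d :
  (forall s d, h s d <= g s d + killed (h s.+1) d) ->
  h 0%N d <= \sum_(0 <= s < t) iter s killed (g s) d + iter t killed (h t) d.
Proof.
move=> hg; elim: t => [|t /le_trans]; first by rewrite big_geq// add0r.
apply; rewrite big_nat_recr//= -addrA lerD2l -iterS iterSr -iter_killedD.
by apply: iter_killed_le => d'; exact: hg.
Qed.

Lemma iter_killed_ge0 t f d : (forall d, 0 <= f d) -> 0 <= iter t killed f d.
Proof.
move=> f0; have <- : iter t killed (fun=> 0) d = 0.
  by elim: t d => //= t IH [|d] //=; rewrite !IH !mulr0 addr0.
exact: iter_killed_le.
Qed.

Lemma survival_ge0 t d : 0 <= survival t d.
Proof. by apply: iter_killed_ge0 => k; rewrite ler0n. Qed.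

Lemma iter_killed_bounded t f C d : (forall d, f d <= C) -> f 0%N <= 0 ->
  iter t killed f d <= C * survival t d.
Proof.
move=> fC f0; rewrite /survival -iter_killedZ; apply: iter_killed_le.
by case=> [|k] /=; rewrite ?mulr0 ?mulr1.
Qed.

(** [h M] and [q M] stand for the first and second moments of the hitting time when the environment
    is cut off at a depth governed by [M]. Writing [T = 1 + T'] gives [E T^2 = E T'^2 + 2 E T - 1],
    the equation for [q]. Beyond the cutoff only inequalities hold, but boundedness in [d] is
    available there. *)
Context (h q : nat -> nat -> R) (hoo qoo : nat -> R).
Hypothesis h_eq0 : forall M, h M 0%N = 0.
Hypothesis q_eq0 : forall M, q M 0%N = 0.
Hypothesis h_ge0 : forall M d, 0 <= h M d.
Hypothesis q_ge0 : forall M d, 0 <= q M d.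
Hypothesis h_sub : forall M d, h M d.+1 <= 1 + killed (h M) d.+1.
Hypothesis h_eq : forall M d, (d < M)%N -> h M d.+1 = 1 + killed (h M) d.+1.
Hypothesis q_sub : forall M d,
  q M d.+1 <= killed (q M) d.+1 + 2 * h M d.+1 - 1.
Hypothesis q_eq : forall M d, (d < M)%N ->
  q M d.+1 = killed (q M) d.+1 + 2 * h M d.+1 - 1.
Hypothesis hq_bounded : forall M, exists C, forall d, h M d <= C /\ q M d <= C.
Hypothesis h_cvg : forall d, h ^~ d @ \oo --> hoo d.
Hypothesis q_cvg : forall d, q ^~ d @ \oo --> qoo d.

Let hoo_eq0 : hoo 0%N = 0.
Proof.
by have <- := cvg_lim (@Rhausdorff R) (@h_cvg 0%N); rewrite (_ : h ^~ 0%N = cst 0) ?lim_cst//; apply/funext.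
Qed.

Let qoo_eq0 : qoo 0%N = 0.
Proof.
by have <- := cvg_lim (@Rhausdorff R) (@q_cvg 0%N); rewrite (_ : q ^~ 0%N = cst 0) ?lim_cst//; apply/funext.
Qed.

Let killed_cvg (f : nat -> nat -> R) foo d : (forall d, f ^~ d @ \oo --> foo d) ->
  (fun M => killed (f M) d) @ \oo --> killed foo d.
Proof.
move=> ff; case: d => [|d] /=; first exact: cvg_cst.
by apply: cvgD; apply: cvgMr; exact: ff.
Qed.

Let hoo_ge0 d : 0 <= hoo d.
Proof.
have <- := cvg_lim (@Rhausdorff R) (@h_cvg d); apply: limr_ge.
  by apply/cvg_ex; exists (hoo d).
by near=> M; exact: h_ge0.
Unshelve. all: by end_near. Qed.

Let qoo_ge0 d : 0 <= qoo d.
Proof.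
have <- := cvg_lim (@Rhausdorff R) (@q_cvg d); apply: limr_ge.
  by apply/cvg_ex; exists (qoo d).
by near=> M; exact: q_ge0.
Unshelve. all: by end_near. Qed.

Let hoo_eq d : hoo d.+1 = 1 + killed hoo d.+1.
Proof.
have H : (fun M => 1 + killed (h M) d.+1) @ \oo --> 1 + killed hoo d.+1.
  by apply: cvgD; [exact: cvg_cst | exact: killed_cvg].
apply: (cvg_unique (@Rhausdorff R) (@h_cvg d.+1)); apply: cvg_trans H.
by apply: near_eq_cvg; near=> M; rewrite -h_eq//; near: M; exact: nbhs_infty_gt.
Unshelve. all: by end_near. Qed.

Let qoo_eq d : qoo d.+1 = killed qoo d.+1 + 2 * hoo d.+1 - 1.
Proof.
have H : (fun M => killed (q M) d.+1 + 2 * h M d.+1 - 1) @ \oo -->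
    killed qoo d.+1 + 2 * hoo d.+1 - 1.
  apply: cvgB; last exact: cvg_cst.
  by apply: cvgD; [exact: killed_cvg | apply: cvgMr; exact: h_cvg].
apply: (cvg_unique (@Rhausdorff R) (@q_cvg d.+1)); apply: cvg_trans H.
by apply: near_eq_cvg; near=> M; rewrite -q_eq//; near: M; exact: nbhs_infty_gt.
Unshelve. all: by end_near. Qed.

Lemma survival_series d : series (survival ^~ d) @ \oo --> hoo d.
Proof.
apply: (@squeeze_series _ (h ^~ d)); last exact: h_cvg.
- by move=> s; exact: survival_ge0.
(* The sign turns the Duhamel inequality into an upper bound on the partial sums; the remainder is
   dropped since [hoo] is nonnegative. *)
- move=> t; pose hh (s d : nat) := - 1 * hoo d.
  have step (s k : nat) : hh s k <= - 1 * (0 < k)%N%:R + killed (hh s.+1) k.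
    case: k => [|k]; rewrite /hh /=; first by rewrite hoo_eq0; lra.
    by rewrite {1}hoo_eq /=; lra.
  have := iter_killed_forced t d step; rewrite /hh iter_killedZ.
  rewrite (eq_bigr (fun s => - survival s d)); last first.
    by move=> s _; rewrite iter_killedZ mulN1r.
  have := iter_killed_ge0 t d hoo_ge0.
  rewrite sumrN /series /=; lra.
- move=> M; have [C HC] := hq_bounded M; exists C => t.
  have step (s k : nat) : h M k <= (0 < k)%N%:R + killed (h M) k.
    by case: k => [|k]; [rewrite h_eq0 /= addr0 | exact: h_sub].
  apply: le_trans (iter_killed_forced t d step) _.
  rewrite lerD2l; apply: iter_killed_bounded; last by rewrite h_eq0.
  by move=> d'; have [] := HC d'.
Qed.

Lemma survival_series2 d :
  series (fun s => (2 * s + 1)%:R * survival s d) @ \oo --> qoo d.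
Proof.
apply: (@squeeze_series _ (q ^~ d)); last exact: q_cvg.
- by move=> s; rewrite mulr_ge0// survival_ge0.
(* [q + 2 s h] is the mean of [(s + T)^2 - s^2]. One step of the walk lowers it on average by
   [(s + 1)^2 - s^2 = 2 s + 1], the weight in the series. *)
- move=> t; pose hh (s d : nat) := - 1 * (qoo d + 2 * s%:R * hoo d).
  have step (s k : nat) :
      hh s k <= - (2 * s + 1)%:R * (0 < k)%N%:R + killed (hh s.+1) k.
    case: k => [|k]; rewrite /hh /=; first by rewrite hoo_eq0 qoo_eq0; lra.
    have := qoo_eq k; have := hoo_eq k; rewrite /= natrD natrM -natr1 => h1 q1.
    rewrite q1; set X := p k.+1 in h1 *.
    have -> : 2 * s%:R * hoo k.+1 =
      2 * s%:R * (1 + (X * hoo k + (1 - X) * hoo k.+2)) :> R by rewrite -h1.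
    rewrite h1; lra.
  have := iter_killed_forced t d step; rewrite /hh iter_killedZ.
  rewrite (eq_bigr (fun s => - ((2 * s + 1)%:R * survival s d))); last first.
    by move=> s _; rewrite iter_killedZ mulNr.
  have : 0 <= iter t killed (fun d => qoo d + 2 * t%:R * hoo d) d.
    by apply: iter_killed_ge0 => k; rewrite addr_ge0// !mulr_ge0.
  rewrite sumrN /series /= mulr0 mul0r addr0; lra.
- move=> M; have [C HC] := hq_bounded M; exists C => t.
  pose hh (s d : nat) := q M d + 2 * s%:R * h M d.
  have step (s k : nat) :
      hh s k <= (2 * s + 1)%:R * (0 < k)%N%:R + killed (hh s.+1) k.
    case: k => [|k]; rewrite /hh /=; first by rewrite h_eq0 q_eq0; lra.
    have := q_sub M k; have := h_sub M k; rewrite /= natrD natrM -natr1 => h1 q1.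
    have : 2 * s%:R * h M k.+1 <= 2 * s%:R *
      (1 + (p k.+1 * h M k + (1 - p k.+1) * h M k.+2)) by rewrite ler_wpM2l// mulr_ge0.
    lra.
  have := iter_killed_forced t d step.
  rewrite /hh mulr0 mul0r addr0 => /le_trans; apply.
  rewrite /series /=; apply: lerD.
    by apply: ler_sum => s _; rewrite iter_killedZ.
  rewrite mulrA; apply: (@le_trans _ _ ((C * (2 * t + 1)%:R) * survival t d)) => //.
  apply: iter_killed_bounded; last by rewrite h_eq0 q_eq0 mulr0 addr0.
  move=> d'; have [h1 q1] := HC d'.
  rewrite natrD natrM mulrDr mulr1 addrC; apply: lerD => //.
  by rewrite mulrC ler_wpM2r// mulr_ge0.
Qed.

End killed_operator.

(** * Crossing moments of one level and their limits *)

Section crossing.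
Context (R : realType).
Implicit Type e : int -> R.

(* Mean and variance of the time needed to go from x to x + 1, for the walk
   reflected at distance j to the left of x (0 when j = 0). *)
Fixpoint cross_mean e (j : nat) (x : int) : R :=
  if j is i.+1 then 1 + rho e x + rho e x * cross_mean e i (x - 1) else 0.

Fixpoint cross_var e (j : nat) (x : int) : R :=
  if j is i.+1 then rho e x * cross_var e i (x - 1) +
    rho e x * (1 + rho e x) * (1 + cross_mean e i (x - 1)) ^+ 2 else 0.

Variable e : int -> R.
Hypothesis e01 : forall i, 0 < e i < 1.

Lemma rho_gt0 i : 0 < rho e i.
Proof. by have /andP[e0 e1] := e01 i; rewrite divr_gt0// subr_gt0. Qed.

Let rho_ge0 i : 0 <= rho e i. Proof. exact/ltW/rho_gt0. Qed.

Lemma cross_mean_ge0 j x : 0 <= cross_mean e j x.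
Proof.
by elim: j x => //= j IH x; rewrite !addr_ge0// mulr_ge0.
Qed.

Lemma cross_var_ge0 j x : 0 <= cross_var e j x.
Proof.
elim: j x => //= j IH x.
apply: addr_ge0; first by rewrite mulr_ge0.
by rewrite mulr_ge0 ?sqr_ge0// mulr_ge0// addr_ge0.
Qed.

Lemma cross_mean_nd x : nondecreasing_seq (cross_mean e ^~ x).
Proof.
apply/nondecreasing_seqP => j; elim: j x => [|j IH] x.
  exact: cross_mean_ge0.
by rewrite [leLHS]/= [leRHS]/= lerD2l ler_wpM2l.
Qed.

Lemma cross_var_nd x : nondecreasing_seq (cross_var e ^~ x).
Proof.
apply/nondecreasing_seqP => j; elim: j x => [|j IH] x; first exact: cross_var_ge0.
rewrite [leLHS]/= [leRHS]/=; apply: lerD; first by rewrite ler_wpM2l.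
apply: ler_wpM2l; first by rewrite mulr_ge0// addr_ge0.
apply: lerXn2r; rewrite ?nnegrE.
- exact: addr_ge0 ler01 (cross_mean_ge0 _ _).
- exact: addr_ge0 ler01 (cross_mean_ge0 j.+1 _).
- by rewrite lerD2l; exact: (cross_mean_nd (x - 1) (leqnSn j)).
Qed.

Lemma cross_mean_ge1 j x : 1 <= cross_mean e j.+1 x.
Proof. by rewrite /= -addrA lerDl addr_ge0// mulr_ge0// cross_mean_ge0. Qed.

Lemma cross_mean_ge_prod j x :
  \prod_(i < j.+1) rho e (x - i%:Z) <= cross_mean e j.+1 x.
Proof.
elim: j x => [|j IH] x.
  by rewrite big_ord1 subr0 /= mulr0 addr0 lerDr.
rewrite big_ord_recl subr0 [leRHS]/= -[leLHS]add0r lerD ?addr_ge0// ler_wpM2l//.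
apply: le_trans (IH _); rewrite le_eqVlt; apply/orP; left; apply/eqP.
by apply: eq_bigr => i _; rewrite lift0 -addrA -opprD -PoszD.
Qed.

(** Only the source term of the variance recursion is kept: it is at least
    [rho_x^2 (1 + a_{x-1})^2], and the product bound for the mean applies to [a_{x-1}]. *)
Lemma cross_var_ge_prod j x :
  (\prod_(i < j.+1) rho e (x - i%:Z)) ^+ 2 <= cross_var e j.+1 x.
Proof.
rewrite big_ord_recl subr0 [leRHS]/= exprMn -[leLHS]add0r.
apply: lerD; first exact: mulr_ge0 (rho_ge0 _) (cross_var_ge0 _ _).
apply: ler_pM; rewrite ?exprn_ge0 ?prodr_ge0//.
  by rewrite expr2 ler_wpM2l// lerDr.
apply: lerXn2r; rewrite ?nnegrE ?prodr_ge0 ?addr_ge0 ?cross_mean_ge0//.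
case: j => [|j]; first by rewrite big_ord0 lerDl cross_mean_ge0.
rewrite -[leLHS]add0r lerD//; apply: le_trans (cross_mean_ge_prod j _).
rewrite le_eqVlt; apply/orP; left; apply/eqP.
by apply: eq_bigr => i _; rewrite lift0 -addrA -opprD -PoszD.
Qed.

Lemma cross_var_ge_rho j x : rho e x <= cross_var e j.+1 x.
Proof.
rewrite /= -[leLHS]add0r.
apply: lerD; first exact: mulr_ge0 (rho_ge0 _) (cross_var_ge0 _ _).
rewrite -mulrA -[leLHS]mulr1 ler_wpM2l// -[leLHS]mulr1.
by apply: ler_pM => //; rewrite ?exprn_ege1 ?lerDl ?cross_mean_ge0.
Qed.

(** The growth estimates concern sites [k >= 0], whereas the walk also visits negative ones. Both
    recursions give [rho_x f_j(x - 1) <= f_{j+1}(x)], so finiteness spreads to the left because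
    [rho_x > 0]. *)
Lemma cross_bounded_left :
  (forall k : nat, exists C, forall j, cross_mean e j k%:Z <= C) ->
  (forall k : nat, exists C, forall j, cross_var e j k%:Z <= C) ->
  forall x, (exists C, forall j, cross_mean e j x <= C) /\
    (exists C, forall j, cross_var e j x <= C).
Proof.
move=> bm bv; case=> [k|k]; first by split.
have step (f : nat -> int -> R) x : (forall j, rho e x * f j (x - 1) <= f j.+1 x) ->
    (exists C, forall j, f j x <= C) -> exists C, forall j, f j (x - 1) <= C.
  move=> fx [C HC]; exists (C / rho e x) => j.
  by rewrite ler_pdivlMr ?rho_gt0// mulrC (le_trans (fx j)).
have neg (f : nat -> int -> R) :
    (forall x j, rho e x * f j (x - 1) <= f j.+1 x) ->
    (exists C, forall j, f j 0 <= C) -> exists C, forall j, f j (- k.+1%:Z) <= C.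
  move=> fx f0; elim: k.+1 => [|m IH]; first by rewrite oppr0.
  by have := step f _ (fx _) IH; rewrite -opprD -PoszD addn1.
rewrite NegzE; split; apply: neg.
- by move=> x j /=; rewrite lerDr addr_ge0.
- exact: bm 0%N.
- by move=> x j /=; rewrite lerDl mulr_ge0 ?sqr_ge0// mulr_ge0// addr_ge0.
- exact: bv 0%N.
Qed.

Lemma sum_vanish_le (F : nat -> R) N d : (forall i, 0 <= F i) ->
  (forall i, (N <= i)%N -> F i = 0) -> \sum_(i < d) F i <= \sum_(i < N) F i.
Proof.
move=> F0 FN; elim: d => [|d IH]; first by rewrite big_ord0 sumr_ge0.
case: (leqP N d) => Nd; first by rewrite big_ord_recr/= FN// addr0.
rewrite -!(big_mkord predT) (@big_cat_nat _ _ _ d.+1 0 N)//= lerDl.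
by rewrite sumr_ge0.
Qed.

Hypothesis cross_mean_bounded : forall x, exists C, forall j, cross_mean e j x <= C.
Hypothesis cross_var_bounded : forall x, exists C, forall j, cross_var e j x <= C.

Definition mean_lim x := limn (cross_mean e ^~ x).
Definition var_lim x := limn (cross_var e ^~ x).

Lemma cross_mean_cvg x : cross_mean e ^~ x @ \oo --> mean_lim x.
Proof.
apply: nondecreasing_is_cvgn; first exact: cross_mean_nd.
by have [C HC] := cross_mean_bounded x; exists C => _ [j _ <-].
Qed.

Lemma cross_var_cvg x : cross_var e ^~ x @ \oo --> var_lim x.
Proof.
apply: nondecreasing_is_cvgn; first exact: cross_var_nd.
by have [C HC] := cross_var_bounded x; exists C => _ [j _ <-].
Qed.

Lemma cross_mean_le_lim j x : cross_mean e j x <= mean_lim x.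
Proof.
apply: nondecreasing_cvgn_le; first exact: cross_mean_nd.
by apply/cvg_ex; exists (mean_lim x); exact: cross_mean_cvg.
Qed.

Lemma cross_var_le_lim j x : cross_var e j x <= var_lim x.
Proof.
apply: nondecreasing_cvgn_le; first exact: cross_var_nd.
by apply/cvg_ex; exists (var_lim x); exact: cross_var_cvg.
Qed.

Variable n : nat.

Let p (d : nat) := e (n%:Z - d%:Z).
(** The depth [M.+1 - i] gives all crossings the same cutoff site [n - (M + 2)]. Truncated
    subtraction makes the terms vanish from there on, so the sums are constant in [d] beyond it. *)
Let h (M d : nat) := \sum_(i < d) cross_mean e (M.+1 - i) (n%:Z - i.+1%:Z).
Let v (M d : nat) := \sum_(i < d) cross_var e (M.+1 - i) (n%:Z - i.+1%:Z).
(* With v the variance and h the mean of the hitting time from distance d, q is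
   its second moment. *)
Let q M d := v M d + h M d ^+ 2.

Let p01 d : 0 <= p d <= 1.
Proof. by have /andP[? ?] := e01 (n%:Z - d%:Z); rewrite !ltW. Qed.

Let h_ge0 M d : 0 <= h M d.
Proof. by apply: sumr_ge0 => i _; exact: cross_mean_ge0. Qed.

Let v_ge0 M d : 0 <= v M d.
Proof. by apply: sumr_ge0 => i _; exact: cross_var_ge0. Qed.

Let hvS M d : [/\ h M d.+1 = h M d + cross_mean e (M.+1 - d) (n%:Z - d.+1%:Z) &
  v M d.+1 = v M d + cross_var e (M.+1 - d) (n%:Z - d.+1%:Z)].
Proof. by rewrite /h /v !big_ord_recr. Qed.

Let stepE M d : (d <= M)%N ->
  h M d.+1 = 1 + killed p (h M) d.+1 /\
  q M d.+1 = killed p (q M) d.+1 + 2 * h M d.+1 - 1.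
Proof.
move=> dM; rewrite /q /=.
have [-> ->] := hvS M d.+1; have [-> ->] := hvS M d.
rewrite subSS (subSn dM) /= /rho -/(p d.+1).
have -> : n%:Z - d.+1%:Z - 1 = n%:Z - d.+2%:Z :> int.
  by rewrite -addrA -opprD -PoszD addn1.
have /andP[p0 _] := e01 (n%:Z - d.+1%:Z).
have pn0 : p d.+1 != 0 by rewrite gt_eqF.
by split; field.
Qed.

(** Past the cutoff both functions are constant in [d], hence harmonic. The inequalities demanded
    there then reduce to [0 <= 1] and [1 <= 2 h]. *)
Let flatE M d : (M < d)%N -> killed p (h M) d.+1 = h M d.+1 /\
  killed p (q M) d.+1 = q M d.+1.
Proof.
move=> Md; rewrite /q /=; have [-> ->] := hvS M d.+1; have [-> ->] := hvS M d.
have -> : (M.+1 - d = 0)%N by apply/eqP; rewrite subn_eq0.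
have -> : (M.+1 - d.+1 = 0)%N by apply/eqP; rewrite subn_eq0 leqW.
by split=> /=; ring.
Qed.

Let h_ge1 M d : 1 <= h M d.+1.
Proof.
rewrite /h big_ord_recl subn0; apply: le_trans (cross_mean_ge1 M (n%:Z - 1)) _.
by rewrite lerDl sumr_ge0// => i _; exact: cross_mean_ge0.
Qed.

Let fuel_cvg (u : nat -> R) (l : R) i : u @ \oo --> l ->
  (fun M => u (M.+1 - i)%N) @ \oo --> l.
Proof.
move=> ul; rewrite -(cvg_centern i) in ul.
by rewrite -cvg_shiftS in ul.
Qed.

Lemma survival_moments :
  series (survival p ^~ n) @ \oo --> \sum_(i < n) mean_lim (n%:Z - i.+1%:Z) /\
  series (fun s => (2 * s + 1)%:R * survival p s n) @ \oo -->
    \sum_(i < n) var_lim (n%:Z - i.+1%:Z) +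
    (\sum_(i < n) mean_lim (n%:Z - i.+1%:Z)) ^+ 2.
Proof.
have h_cvg d : h ^~ d @ \oo --> \sum_(i < d) mean_lim (n%:Z - i.+1%:Z).
  apply: cvg_big => [|i _]; [exact: add_continuous|exact: (fuel_cvg i (@cross_mean_cvg (n%:Z - i.+1%:Z)))].
have v_cvg d : v ^~ d @ \oo --> \sum_(i < d) var_lim (n%:Z - i.+1%:Z).
  apply: cvg_big => [|i _]; [exact: add_continuous|exact: (fuel_cvg i (@cross_var_cvg (n%:Z - i.+1%:Z)))].
have q_cvg d : q ^~ d @ \oo --> \sum_(i < d) var_lim (n%:Z - i.+1%:Z) +
    (\sum_(i < d) mean_lim (n%:Z - i.+1%:Z)) ^+ 2.
  apply: cvgD; first exact: v_cvg.
  by rewrite expr2; under eq_fun do rewrite expr2; apply: cvgM; exact: h_cvg.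
have h0 M : h M 0%N = 0 by rewrite /h big_ord0.
have q0 M : q M 0%N = 0 by rewrite /q h0 /v big_ord0 add0r expr0n.
have q_ge0 M d : 0 <= q M d by rewrite addr_ge0// exprn_ge0.
have h_sub M d : h M d.+1 <= 1 + killed p (h M) d.+1.
  case: (leqP d M) => dM; first by have [<-] := stepE dM.
  by have [-> _] := flatE dM; rewrite lerDr.
have h_eq M d : (d < M)%N -> h M d.+1 = 1 + killed p (h M) d.+1.
  by move=> /ltnW dM; have [] := stepE dM.
have q_sub M d : q M d.+1 <= killed p (q M) d.+1 + 2 * h M d.+1 - 1.
  case: (leqP d M) => dM; first by have [_ <-] := stepE dM.
  by have [_ ->] := flatE dM; have := h_ge1 M d; lra.
have q_eq M d : (d < M)%N ->
    q M d.+1 = killed p (q M) d.+1 + 2 * h M d.+1 - 1.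
  by move=> /ltnW dM; have [] := stepE dM.
have bounded M : exists C, forall d, h M d <= C /\ q M d <= C.
  have hC d : h M d <= h M M.+1.
    apply: (@sum_vanish_le (fun i => cross_mean e (M.+1 - i) (n%:Z - i.+1%:Z))).
      by move=> i; exact: cross_mean_ge0.
    by move=> i; rewrite -subn_eq0 => /eqP ->.
  have vC d : v M d <= v M M.+1.
    apply: (@sum_vanish_le (fun i => cross_var e (M.+1 - i) (n%:Z - i.+1%:Z))).
      by move=> i; exact: cross_var_ge0.
    by move=> i; rewrite -subn_eq0 => /eqP ->.
  exists (h M M.+1 + q M M.+1) => d; split.
    by apply: le_trans (hC d) _; rewrite lerDl.
  apply: (@le_trans _ _ (q M M.+1)); last by rewrite lerDr.
  by apply: lerD => //; apply: lerXn2r; rewrite ?nnegrE.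
split.
- exact: (survival_series p01 h0 h_ge0 h_sub h_eq bounded h_cvg).
- exact: (survival_series2 p01 h0 q0 h_ge0 q_ge0 h_sub h_eq q_sub q_eq bounded h_cvg q_cvg).
Qed.

End crossing.

(** * Events decomposed along a countably valued map *)

Section countable_valued.
Context d (T : measurableType d) (R : realType) (Q : probability T R).
Context (C : countType) (g : T -> C).

Lemma preimage_countable (B : set C) : g @^-1` B =
  \bigcup_i [set w | pickle (g w) = i /\ B (g w)].
Proof.
apply/seteqP; split=> w /=; first by move=> Bw; exists (pickle (g w)).
by case=> i _ [].
Qed.

Hypothesis mg : forall c, measurable (g @^-1` [set c]).

Lemma measurable_pickle (A : set T) i : measurable A ->
  measurable (A `&` [set w | pickle (g w) = i]).
Proof.
move=> mA; apply: measurableI => //.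
case: (pselect (exists w, pickle (g w) = i)) => [[w0 w0i]|no].
  suff -> : [set w | pickle (g w) = i] = g @^-1` [set g w0] by [].
  apply/seteqP; split=> w /= => [wi|-> //].
  by apply: (pcan_inj pickleK); rewrite wi w0i.
suff -> : [set w | pickle (g w) = i] = set0 by [].
by apply/seteqP; split=> w //= wi; apply: no; exists w.
Qed.

Lemma measurable_countable_valued (B : set C) : measurable (g @^-1` B).
Proof.
rewrite preimage_countable; apply: bigcup_measurable => i _.
case: (pselect (exists w, pickle (g w) = i /\ B (g w))) => [[w0 [w0i Bw0]]|no].
  suff -> : [set w | pickle (g w) = i /\ B (g w)] = g @^-1` [set g w0] by [].
  apply/seteqP; split=> w /= => [[wi _]|-> //].
  by apply: (pcan_inj pickleK); rewrite wi w0i.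
suff -> : [set w | pickle (g w) = i /\ B (g w)] = set0 by [].
by apply/seteqP; split=> w //= [wi Bw]; apply: no; exists w.
Qed.

Lemma measure_countable_split (A : set T) : measurable A ->
  Q A = (\sum_(i <oo) Q (A `&` [set w | pickle (g w) = i]))%E.
Proof.
move=> mA.
transitivity (Q (\bigcup_i (A `&` [set w | pickle (g w) = i]))).
  congr (Q _); apply/seteqP; split=> [w Aw|w [i _ []//]].
  by exists (pickle (g w)).
rewrite measure_bigcup//; last 2 first.
- by move=> i _; exact: measurable_pickle.
- by move=> i j _ _ [w [[_ /= <-] [_ /= <-]]].
by apply: eq_eseriesl => i; rewrite in_setT.
Qed.

Lemma measure_countable0 (A : set T) : measurable A ->
  (forall c, Q (A `&` g @^-1` [set c]) = 0%E) -> Q A = 0%E.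
Proof.
move=> mA A0; rewrite measure_countable_split//; apply: eseries0 => i _ _.
case: (pselect (exists w, pickle (g w) = i)) => [[w0 w0i]|no].
  rewrite -(A0 (g w0)); congr (Q (_ `&` _)).
  apply/seteqP; split=> w /= => [wi|-> //].
  by apply: (pcan_inj pickleK); rewrite wi w0i.
rewrite -(measure0 Q); congr (Q _).
by apply/seteqP; split=> w //= [_ wi]; apply: no; exists w.
Qed.

End countable_valued.

(** * The law of the walk before it hits its target *)

Section quenched_survival.
Context d (T : measurableType d) (R : realType) (Q : probability T R).
Context (X : nat -> T -> int) (e : int -> R).
Hypothesis walk : walk_in_environment Q X e.

Let trajectory t w := [seq X k w | k <- iota 0 t.+1].

Let nth_trajectory t w k : (k <= t)%N -> nth 0 (trajectory t w) k = X k w.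
Proof. by move=> kt; rewrite (nth_map 0%N) ?size_iota// nth_iota. Qed.

Let trajectoryP t w w' : trajectory t w = trajectory t w' <->
  forall k, (k <= t)%N -> X k w = X k w'.
Proof.
split=> [E k kt|E]; first by rewrite -!(nth_trajectory _ kt) E.
by apply/eq_in_map => k; rewrite mem_iota add0n ltnS => /= /E.
Qed.

Let measurable_trajectory t s : measurable (trajectory t @^-1` [set s]).
Proof.
have [mX _ _] := walk.
case: (pselect (exists w, trajectory t w = s)) => [[w0 <-]|no]; last first.
  suff -> : trajectory t @^-1` [set s] = set0 by [].
  by apply/seteqP; split=> w //= wi; apply: no; exists w.
rewrite (_ : _ @^-1` _ =
    \bigcap_k if (k <= t)%N then X k @^-1` [set X k w0] else setT).
  by apply: bigcapT_measurable => k; case: ifP.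
apply/seteqP; split=> w /=.
  by move/trajectoryP => H k _; case: ifPn => // /H.
by move=> H; apply/trajectoryP => k kt; have := H k I; rewrite kt.
Qed.

Variable n : nat.

Definition avoids (t : nat) : set T :=
  [set w | forall s, (s <= t)%N -> X s w <> n%:Z].

Lemma measurable_avoids t : measurable (avoids t).
Proof.
rewrite (_ : avoids t = trajectory t @^-1`
  [set s | forall k, (k <= t)%N -> nth 0 s k <> n%:Z]).
  by apply: measurable_countable_valued; exact: measurable_trajectory.
by apply/seteqP; split=> w H k kt; have := H k kt; rewrite nth_trajectory.
Qed.

Let measurable_at t x : measurable (avoids t `&` X t @^-1` [set x]).
Proof.
by have [mX _ _] := walk; apply: measurableI => //; exact: measurable_avoids.
Qed.

(** The path formula concerns single trajectories. The event splits into countably many trajectories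
    up to time [t], each contributing the same transition factor. *)
Let markov t y z :
  Q (avoids t `&` X t @^-1` [set y] `&` X t.+1 @^-1` [set z]) =
  (Q (avoids t `&` X t @^-1` [set y]) * (transition e y z)%:E)%E.
Proof.
have [mX _ step] := walk.
rewrite (measure_countable_split _ (@measurable_trajectory t)); last exact: measurableI.
rewrite [in RHS](measure_countable_split _ (@measurable_trajectory t))//.
rewrite muleC -nneseriesZl//; apply: eq_eseriesr => i _.
set A := avoids t `&` _.
case: (pselect (exists w, A w /\ pickle (trajectory t w) = i)) => [[w0 [Aw0 w0i]]|no]; last first.
  rewrite (_ : A `&` _ `&` _ = set0); last first.
    by apply/seteqP; split=> w //= [[Aw _] wi]; apply: no; exists w.
  rewrite (_ : A `&` _ = set0) ?measure0 ?mule0//.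
  by apply/seteqP; split=> w //= [Aw wi]; apply: no; exists w.
(* The trajectory of [w0] continued by [z], so that the path formula at time [t] yields the
   transition from [y] to [z]. *)
pose x k := if (k <= t)%N then X k w0 else z.
have Axy : A `&` [set w | pickle (trajectory t w) = i] =
    [set w | forall k, (k <= t)%N -> X k w = x k].
  apply/seteqP; split=> [w [_ /= wi] k kt|w H].
    rewrite /x kt; move: k kt; apply/trajectoryP.
    by apply: (pcan_inj pickleK); rewrite wi w0i.
  have E : trajectory t w = trajectory t w0.
    by apply/trajectoryP => k kt; rewrite H// /x kt.
  split; last by rewrite /= E.
  case: Aw0 => a0 y0; have /trajectoryP E' := E.
  by split=> [s st|/=]; rewrite E'//; exact: a0.
have yx : y = x t by rewrite /x leqnn; case: Aw0 => _ /= ->.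
have zx : z = x t.+1 by rewrite /x ltnn.
rewrite setIAC Axy {1}zx yx zx muleC -step; congr (Q _).
apply/seteqP; split=> [w [H Hz] k|w H].
  by rewrite leq_eqVlt => /orP[/eqP ->//|]; rewrite ltnS; exact: H.
by split=> [k kt|/=]; rewrite H//; exact: leqW.
Qed.

Let markov_sum t x : Q (avoids t `&` X t.+1 @^-1` [set x]) =
  (Q (avoids t `&` X t @^-1` [set (x - 1)%R]) * (e (x - 1)%R)%:E +
   Q (avoids t `&` X t @^-1` [set (x + 1)%R]) * (1 - e (x + 1))%:E)%E.
Proof.
have [mX _ _] := walk.
have <- : transition e (x - 1) x = e (x - 1) by rewrite /transition subrK eqxx.
have <- : transition e (x + 1) x = 1 - e (x + 1).
  by rewrite /transition addrK eqxx; case: eqP => //; lia.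
rewrite -!markov -measureU//; last 3 first.
- exact: measurableI.
- exact: measurableI.
- apply/seteqP; split=> w //= [[[_ a] _] [[_ b] _]].
  by move: b; rewrite a; lia.
set U := (X in _ = Q X).
have UA : U `<=` avoids t `&` X t.+1 @^-1` [set x] by move=> w /= [][[]].
have mU : measurable U by apply: measurableU; exact: measurableI.
have mA : measurable (avoids t `&` X t.+1 @^-1` [set x]).
  by apply: measurableI => //; exact: measurable_avoids.
rewrite -(setDUK UA) measureU//; last 2 first.
- exact: measurableD.
- by rewrite setDE setICA setICr setI0.
(* What remains are jumps from elsewhere than [x - 1] and [x + 1]. They form a null event, as one
   sees by splitting along the value of [X t]. *)
rewrite [X in (_ + X)%E = _](_ : _ = 0%E) ?adde0//.
apply: (measure_countable0 (g := X t)) => //; first exact: measurableD.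
move=> y; case: (pselect (y = x - 1 \/ y = x + 1)) => yx.
  rewrite -(measure0 Q); congr (Q _); apply/seteqP; split=> w //= [[[a b] nU] c].
  by apply: nU; case: yx => yE; [left|right]; split=> //; split=> //=; rewrite c.
have tr0 : transition e y x = 0.
  rewrite /transition; case: eqP => [xy|_]; first by exfalso; apply: yx; left; lia.
  by case: eqP => // xy; exfalso; apply: yx; right; lia.
apply/eqP; rewrite eq_le measure_ge0 andbT.
rewrite (_ : 0%E = Q (avoids t `&` X t @^-1` [set y] `&` X t.+1 @^-1` [set x])); last first.
  by rewrite markov tr0 mule0.
apply: le_measure; rewrite ?inE//.
- by apply: measurableI => //; exact: measurableD.
- exact: measurableI.
- by move=> w /= [[[a b] nU] c].
Qed.

Let p (d : nat) := e (n%:Z - d%:Z).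

Let dirac (k d : nat) : R := (d == k)%:R.

(** Forward equation: the innermost application is expanded, that is, the last step of the walk.
    Distance [k.+1] is entered from [k.+2] or from [k]; for [k = 0] the latter is the target, where
    the walk has been killed. *)
Let iter_killed_dirac t k j : iter t.+1 (killed p) (dirac k.+1) j =
  p k.+2 * iter t (killed p) (dirac k.+2) j +
  if k is 0%N then 0 else (1 - p k) * iter t (killed p) (dirac k) j.
Proof.
case: k => [|k].
  rewrite addr0 iterSr -iter_killedZ; congr (iter _ _ _ _); apply/funext.
  case=> [|d'] /=; first by rewrite mulr0.
  by rewrite /dirac !eqSS /=; case: eqP => [->|_] /=; ring.
rewrite iterSr -!iter_killedZ -iter_killedD; congr (iter _ _ _ _); apply/funext.
case=> [|d'] /=; first by rewrite !mulr0 addr0.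
rewrite /dirac !eqSS; congr (_ + _).
  by case: eqP => [->|_] //=; ring.
by case: eqP => [->|_] //=; ring.
Qed.

Let avoids_at_target t : avoids t `&` X t @^-1` [set n%:Z] = set0.
Proof. by apply/seteqP; split=> w //= [/(_ t (leqnn t))]. Qed.

Let avoidsS_at t x : x <> n%:Z -> avoids t.+1 `&` X t.+1 @^-1` [set x] =
  avoids t `&` X t.+1 @^-1` [set x].
Proof.
move=> xn; apply/seteqP; split=> w /= [H Xw]; split=> // s st.
  by apply: H; exact: leqW.
by move: st; rewrite leq_eqVlt => /orP[/eqP ->|]; [rewrite Xw|exact: H].
Qed.

(** Both halves advance together: arrivals from the right of [n] must be excluded in the forward
    equation, and that side is entered only through [n]. *)
Let at_distance t : (forall k,
    Q (avoids t `&` X t @^-1` [set n%:Z - k.+1%:Z]) =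
      (iter t (killed p) (dirac k.+1) n)%:E) /\
  forall x, n%:Z < x -> Q (avoids t `&` X t @^-1` [set x]) = 0%E.
Proof.
have [mX X0 _] := walk.
have E0 x : x <> n%:Z ->
    Q (avoids 0%N `&` X 0%N @^-1` [set x]) = (x == 0)%:R%:E.
  move=> xn; have [x0|x0] := eqVneq x 0.
    rewrite x0 -X0; congr (Q _); apply/seteqP; split=> [w []//|w /= Xw].
    by split=> // s; rewrite leqn0 => /eqP -> /=; rewrite Xw -x0.
  rewrite (_ : false%:R%:E = 0%E)//.
  apply/eqP; rewrite eq_le measure_ge0 andbT.
  have -> : 0%E = Q (~` (X 0%N @^-1` [set 0])).
    by rewrite probability_setC// X0 subee.
  apply: le_measure; rewrite ?inE//; first exact: measurableC.
  by move=> w /= [_ ->]; exact/eqP.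
elim: t => [|t [IH1 IH2]]; first split.
- move=> k; rewrite E0 /=; last by lia.
  by congr (_ %:R%:E); rewrite -(inj_eq (@addIr _ k.+1%:Z)) subrK add0r.
- by move=> x nx; rewrite E0; [case: eqP => // x0; exfalso; lia | lia].
split=> [k|x nx]; last first.
  rewrite avoidsS_at; last by lia.
  rewrite markov_sum (IH2 (x + 1)) ?mul0e ?adde0; last by lia.
  have [->|xn] := eqVneq (x - 1) n%:Z; first by rewrite avoids_at_target measure0 mul0e.
  by rewrite IH2 ?mul0e//; lia.
rewrite avoidsS_at; last by lia.
rewrite markov_sum iter_killed_dirac.
have -> : n%:Z - k.+1%:Z - 1 = n%:Z - k.+2%:Z :> int by lia.
have -> : n%:Z - k.+1%:Z + 1 = n%:Z - k%:Z :> int by lia.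
rewrite IH1 [RHS]EFinD [in RHS]EFinM [X in _ = (X + _)%E]muleC; congr (_ + _)%E.
case: k => [|k]; first by rewrite subr0 avoids_at_target measure0 mul0e.
by rewrite IH1 -EFinM mulrC.
Qed.

(** Finite speed of propagation: [t] steps from a distance at most [m] see only distances up to
    [m + t]. *)
Let iter_killed_local t f g m j : (j <= m)%N ->
  (forall k, (k <= m + t)%N -> f k = g k) ->
  iter t (killed p) f j = iter t (killed p) g j.
Proof.
elim: t m j => [|t IH] m j jm fg /=; first by apply: fg; rewrite addn0.
case: j jm => [//|j] jm /=.
by rewrite !(IH m.+1)// ?addSnnS// ltnW// ltnW.
Qed.

Lemma quenched_survival t : Q (avoids t) = (survival p t n)%:E.
Proof.
have [mX _ _] := walk; have [at1 at2] := at_distance t.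
pose F k := avoids t `&` X t @^-1` [set n%:Z - k.+1%:Z].
have mF k : measurable (F k) by exact: measurable_at.
(* From distance [n] the walk is within distance [n + t] at time [t], so these finitely many
   positions carry all the mass. *)
pose U := \big[setU/set0]_(k < n + t) F k.
have mU : measurable U by exact: bigsetU_measurable.
have UA : U `<=` avoids t.
  by rewrite /U -bigcup_mkord => w [k _ []].
rewrite -(setDUK UA) measureU//; last 2 first.
- by apply: measurableD => //; exact: measurable_avoids.
- by rewrite setDE setICA setICr setI0.
rewrite [X in (_ + X)%E = _](_ : _ = 0%E) ?adde0; last first.
  apply: (measure_countable0 (g := X t)) => //.
    by apply: measurableD => //; exact: measurable_avoids.
  move=> y; apply/eqP; rewrite eq_le measure_ge0 andbT.
  case: (ltgtP y n%:Z) => yn.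
  - have [k ky] : exists k : nat, y = n%:Z - k.+1%:Z.
      by exists (absz (n%:Z - y - 1)%R); lia.
    have [kN|kN] := ltnP k (n + t).
      rewrite (_ : _ `&` _ = set0) ?measure0//; apply/seteqP; split=> w //=.
      move=> [[Aw nU] Xy]; apply: nU; rewrite /U -bigcup_mkord; exists k => //.
      by split=> //=; rewrite -ky.
    have : Q (F k) = 0%E.
      rewrite /F at1; congr (_ %:E).
      rewrite (@iter_killed_local _ _ (fun=> 0) n)//.
        by elim: (t) (n) => //= t' IH [|d'] //=; rewrite !IH !mulr0 addr0.
      by move=> j jN; rewrite /dirac; case: eqP => // jk; move: jN; rewrite jk ltnNge kN.
    move=> <-; apply: le_measure; rewrite ?inE//.
      by apply: measurableI => //; apply: measurableD => //; exact: measurable_avoids.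
    by move=> w /= [[Aw _] Xy]; split=> //=; rewrite -ky.
  - rewrite -(at2 _ yn); apply: le_measure; rewrite ?inE//.
      by apply: measurableI => //; apply: measurableD => //; exact: measurable_avoids.
    by move=> w /= [[Aw _] Xy].
  - rewrite (_ : _ `&` _ = set0) ?measure0//; apply/seteqP; split=> w //=.
    by rewrite yn => -[[/(_ t (leqnn t))]].
rewrite /U measure_bigsetU//; last first.
  by move=> i j _ _ [w [[_ /= a] [_ /= b]]]; lia.
rewrite (eq_bigr (fun k : 'I_(n + t) => (iter t (killed p) (dirac k.+1) n)%:E)); last first.
  by move=> k _; exact: at1.
rewrite sumEFin; congr (_ %:E).
(* Up to distance [n + t] this sum agrees with the indicator of positive distances that defines
   [survival]; locality makes the rest irrelevant. *)
transitivity (iter t (killed p) (fun d => \sum_(k < n + t) dirac k.+1 d) n).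
  elim: (n + t)%N => [|N IH].
    rewrite big_ord0; transitivity (iter t (killed p) (fun=> 0) n).
      by elim: (t) (n) => //= t' IH [|d'] //=; rewrite -!IH !mulr0 addr0.
    by congr (iter _ _ _ _); apply/funext => d'; rewrite big_ord0.
  rewrite big_ord_recr /= IH -iter_killedD; congr (iter _ _ _ _).
  by apply/funext => d'; rewrite big_ord_recr.
apply: (@iter_killed_local _ _ _ n) => // d' dN.
case: d' dN => [|d'] dN.
  by rewrite big1// => i _; rewrite /dirac.
rewrite (bigD1 (Ordinal dN))//= /dirac eqxx big1 ?addr0// => i iN.
by rewrite eqSS; case: eqP => // di; move: iN; rewrite -val_eqE /= di eqxx.
Qed.

End quenched_survival.

(** * Mean and variance of a hitting time from its tails *)

Section hitting_time_moments.
Context d (T : measurableType d) (R : realType) (Q : probability T R).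
Context (X : nat -> T -> int) (e : int -> R).
Hypothesis walk : walk_in_environment Q X e.
Variable n : nat.

Let H : T -> \bar R := hitting_time R X n.

(** A level first hit at time [L] has been avoided exactly up to each [l < L]. General weights [c]
    cover the series for [T] ([c = 1]) and for [T^2] ([c l = 2 l + 1]); weights at least 1 make the
    series diverge when the level is never hit. *)
Let hitting_timeP w :
  (exists L, H w = L%:R%:E /\ forall c : nat -> R,
    (forall l, 0 <= c l) ->
    (\sum_(l <oo) (c l * \1_(avoids X n l) w)%:E = (\sum_(l < L) c l)%:E)%E) \/
  (H w = +oo%E /\ forall c : nat -> R,
    (forall l, 1 <= c l) ->
    (\sum_(l <oo) (c l * \1_(avoids X n l) w)%:E = +oo)%E).
Proof.
case: (pselect (exists l, X l w == n%:Z)) => [ex|no]; [left|right].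
  case: (ex_minnP ex) => L /eqP XL minL; exists L; split.
    apply/eqP; rewrite eq_le; apply/andP; split.
      by apply: ereal_inf_lbound; exists L.
    apply: le_ereal_inf_tmp => _ [l /= /eqP Xl <-].
    by rewrite lee_fin ler_nat minL.
  move=> c c0; rewrite (nneseries_split 0 L); last first.
    by move=> k _; rewrite lee_fin mulr_ge0.
  rewrite add0n eseries0 ?adde0; last first.
    move=> l Ll _; rewrite indicE memNset ?mulr0//.
    by move=> /(_ L Ll).
  rewrite big_mkord sumEFin; congr (_ %:E); apply: eq_bigr => l _.
  rewrite indicE mem_set ?mulr1// => s sl Xs.
  have := minL s; rewrite Xs eqxx => /(_ isT).
  by rewrite leqNgt (leq_ltn_trans sl).
split.
  rewrite /H /hitting_time (_ : [set l : nat | _] = set0) ?image_set0 ?ereal_inf0//.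
  by apply/seteqP; split=> l //= Xl; apply: no; exists l; apply/eqP.
move=> c c1; apply: eq_infty => r.
have c0 l : 0 <= c l by apply: le_trans (c1 l); rewrite ler01.
pose N := Num.bound `|r|.
apply: (@le_trans _ _ (\sum_(0 <= l < N) (c l * \1_(avoids X n l) w)%:E)%E); last first.
  by apply: nneseries_lim_ge => l _ _; rewrite lee_fin mulr_ge0.
rewrite sumEFin lee_fin; apply: (@le_trans _ _ N%:R).
  by apply: le_trans (ler_norm r) _; exact/ltW/archi_boundP.
rewrite (_ : N%:R = \sum_(0 <= l < N) 1 :> R); last by rewrite sumr_const_nat subn0.
apply: ler_sum => l _; rewrite indicE mem_set ?mulr1//.
by move=> s sl Xs; apply: no; exists s; apply/eqP.
Qed.

Let H_ge0 w : (0 <= H w)%E.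
Proof. by case: (hitting_timeP w) => [[L [-> _]]|[-> _]]; rewrite ?lee_fin. Qed.

Let H_series w : H w = (\sum_(l <oo) (\1_(avoids X n l) w)%:E)%E.
Proof.
case: (hitting_timeP w) => [[L [-> E]]|[-> E]].
  have /= := E (fun=> 1) (fun=> ler01).
  by rewrite sumr_const card_ord => <-; apply: eq_eseriesr => l _; rewrite mul1r.
by rewrite -(E (fun=> 1))//; apply: eq_eseriesr => l _; rewrite mul1r.
Qed.

Let H2_series w : (H w * H w = \sum_(l <oo) ((2 * l + 1)%:R * \1_(avoids X n l) w)%:E)%E.
Proof.
case: (hitting_timeP w) => [[L [-> E]]|[-> E]]; last first.
  by rewrite E ?mulyy// => l; rewrite ler1n addn1.
rewrite E// -EFinM; congr (_ %:E); elim: L {E} => [|L IH].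
  by rewrite big_ord0 mulr0.
by rewrite big_ord_recr /= -IH natrD natrM -natr1; ring.
Qed.

Let mavoids l : measurable (avoids X n l).
Proof. exact: (measurable_avoids walk). Qed.

Let measurable_weighted (c : nat -> R) l :
  measurable_fun setT (fun w => (c l * \1_(avoids X n l) w)%:E).
Proof.
apply/measurable_EFinP/measurable_funM; first exact: measurable_cst.
exact: measurable_indic.
Qed.

Let integral_weighted (c : nat -> R) : (forall l, 0 <= c l) ->
  (\int[Q]_w (\sum_(l <oo) (c l * \1_(avoids X n l) w)%:E) =
  \sum_(l <oo) (c l * survival (fun k => e (n%:Z - k%:Z)) l n)%:E)%E.
Proof.
move=> c0; rewrite integral_nneseries//; last first.
  by move=> l w _; rewrite lee_fin mulr_ge0.
apply: eq_eseriesr => l _; under eq_integral do rewrite EFinM.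
rewrite ge0_integralZl_EFin//; last first.
  by apply/measurable_EFinP; exact: measurable_indic.
  by rewrite EFinM -(quenched_survival walk) integral_indic// setIT.
Qed.

Let measurable_H : measurable_fun setT H.
Proof.
rewrite (_ : H = fun w => \sum_(l <oo) (\1_(avoids X n l) w)%:E)%E; last first.
  by apply/funext => w; exact: H_series.
by apply: ge0_emeasurable_sum => // l _; exact/measurable_EFinP/measurable_indic.
Qed.

Let eseries_lim (u : nat -> R) (l : R) : series u @ \oo --> l ->
  (\sum_(k <oo) (u k)%:E = l%:E)%E.
Proof.
move=> ul; apply/cvg_lim => //.
under eq_cvg do rewrite sumEFin.
by apply: cvg_EFin => //; near=> k.
Unshelve. all: by end_near. Qed.

Variables m v : R.
Let p (k : nat) := e (n%:Z - k%:Z).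
Hypothesis m_lim : series (survival p ^~ n) @ \oo --> m.
Hypothesis m2_lim :
  series (fun s => (2 * s + 1)%:R * survival p s n) @ \oo --> v + m ^+ 2.

Lemma expectation_hitting_time : expectatione Q (hitting_time R X n) = m%:E.
Proof.
rewrite /expectatione -/H; under eq_integral do rewrite H_series.
rewrite -(eseries_lim m_lim) -[RHS](@eq_eseriesr _ (fun l => (1 * survival p l n)%:E)); last first.
  by move=> l _; rewrite mul1r.
rewrite -integral_weighted//; apply: eq_integral => w _.
by apply: eq_eseriesr => l _; rewrite mul1r.
Qed.

Lemma variance_hitting_time : 0 <= m -> variancee Q (hitting_time R X n) = v%:E.
Proof.
move=> m0; rewrite /variancee expectation_hitting_time -/H /expectatione.
have E2 : (\int[Q]_w (H w * H w) = (v + m ^+ 2)%:E)%E.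
  under eq_integral do rewrite H2_series.
  by rewrite integral_weighted//; exact: eseries_lim.
have mB : measurable_fun setT (fun w => (H w - m%:E) ^+ 2)%E.
  apply: (eq_measurable_fun (fun w => (H w - m%:E) * (H w - m%:E))%E) => //.
  by apply: emeasurable_funM; apply: emeasurable_funB => //; exact: measurable_cst.
have B0 w : (0 <= (H w - m%:E) ^+ 2)%E by exact: sqre_ge0.
(* [(H - m)^2 + 2 m H = H^2 + m^2] has nonnegative terms only, so it may be integrated termwise even
   where [H] is infinite; finite quantities are cancelled afterwards. *)
have key : (\int[Q]_w (H w - m%:E) ^+ 2 + (2 * m)%:E * m%:E = (v + m ^+ 2)%:E + (m ^+ 2)%:E)%E.
  rewrite -{2}expectation_hitting_time -/H /expectatione -ge0_integralZl//; last by rewrite lee_fin mulr_ge0.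
  rewrite -ge0_integralD//; last 2 first.
    by move=> w _; rewrite mule_ge0// lee_fin mulr_ge0.
    by apply: emeasurable_funM => //; exact: measurable_cst.
  rewrite -E2 -[X in (_ + X)%E](_ : \int[Q]__ (m ^+ 2)%:E = _)%E; last first.
    by rewrite integral_cst// [X in (_ * X)%E]probability_setT mule1.
  rewrite -ge0_integralD//; last 3 first.
    by move=> w _; rewrite mule_ge0.
    by apply: emeasurable_funM.
    by move=> w _; rewrite lee_fin sqr_ge0.
  apply: eq_integral => w _; case: (hitting_timeP w) => [[L [-> _]]|[-> _]].
    by rewrite -EFinB -EFin_expe -!EFinM -!EFinD; congr (_ %:E); ring.
  have -> : ((+oo - m%:E) ^+ 2 = +oo :> \bar R)%E by rewrite addye// expeS expe1 mulyy.
  rewrite mulyy !addye// gt_eqF//; apply: (@lt_le_trans _ _ 0%E) => //.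
  by rewrite mule_ge0// lee_fin mulr_ge0.
move: key; case: (\int[Q]_w _)%E => [r| |] //.
by rewrite -!EFinM -!EFinD => -[] rE; congr (_ %:E); move: rE; rewrite expr2; lra.
Qed.

End hitting_time_moments.
(** * Upper bounds on the environment *)

(** Strict weighted AM-GM for 1 and [x^s'], with [t = s / s'] and [u = s' ln x]. After factoring out
    [e^(t u)], the inequality [1 + y < e^y] is used at [(1 - t) u] and [- t u], whose linear terms
    cancel. *)
Lemma powR_weighted_mean (R : realType) (x s s' : R) : 0 < x -> x != 1 ->
  0 < s -> s < s' -> x `^ s < 1 - s / s' + s / s' * x `^ s'.
Proof.
move=> x0 x1 s0 ss'; have s'0 : 0 < s' by exact: lt_trans ss'.
set t := s / s'; set u := s' * ln x.
have t0 : 0 < t by rewrite divr_gt0.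
have t1 : t < 1 by rewrite ltr_pdivrMr// mul1r.
have u0 : u != 0 by rewrite mulf_neq0 ?ln_eq0// gt_eqF.
have -> : x `^ s = expR (t * u).
  by rewrite /powR gt_eqF// /t /u mulrA divfK// gt_eqF.
have -> : x `^ s' = expR u by rewrite /powR gt_eqF.
have E1 : 1 + (1 - t) * u < expR ((1 - t) * u).
  by rewrite expR_gt1Dx// mulf_neq0// subr_eq0 gt_eqF.
have E2 : 1 + - (t * u) < expR (- (t * u)).
  by rewrite expR_gt1Dx// oppr_eq0 mulf_neq0// gt_eqF.
have -> : expR u = expR (t * u) * expR ((1 - t) * u).
  by rewrite -expRD; congr expR; ring.
have E3 : expR (t * u) * expR (- (t * u)) = 1 by rewrite -expRD subrr expR0.
have p0 := expR_gt0 (t * u).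
rewrite -{1}[expR (t * u)]mulr1.
have -> : 1 - t + t * (expR (t * u) * expR ((1 - t) * u)) =
  expR (t * u) * ((1 - t) * expR (- (t * u)) + t * expR ((1 - t) * u)).
  transitivity ((1 - t) * (expR (t * u) * expR (- (t * u))) +
    t * (expR (t * u) * expR ((1 - t) * u))); last by ring.
  by rewrite E3; ring.
rewrite ltr_pM2l//.
have : t * (1 + (1 - t) * u) < t * expR ((1 - t) * u) by rewrite ltr_pM2l.
have : (1 - t) * (1 + - (t * u)) < (1 - t) * expR (- (t * u)).
  by rewrite ltr_pM2l// subr_gt0.
lra.
Qed.

(** * Moments of [rho_0] on either side of [kappa] *)

Section environment.
Context (R : realType) (d : measure_display) (Omega : measurableType d).
Context (P : probability Omega R) (omega : int -> {RV P >-> R}).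
Hypothesis omega_iid : iid omega.
Hypothesis omega01 : forall i w, 0 < omega i w < 1.

Let r (i : int) (w : Omega) : R := rho (omega ^~ w) i.

(** The reciprocal is written as a real power for the sake of measurability on the whole line. *)
Let odds (x : R) : R := (1 - x) * x `^ (-1).

Let measurable_odds : measurable_fun [set: R] odds.
Proof.
apply: measurable_funM; last exact: measurable_powR.
by apply: measurable_funB => //; exact: measurable_cst.
Qed.

Let rE i w : r i w = odds (omega i w).
Proof.
have /andP[w0 _] := omega01 i w.
by rewrite /r /rho /odds powR_inv1// ltW.
Qed.

Let r_gt0 i w : 0 < r i w. Proof. exact: rho_gt0. Qed.

Lemma rect_measurable_rho (S : set int) i : S i ->
  rect_measurable_fun omega S (r i).
Proof.
move=> Si; rewrite /rect_measurable_fun (_ : r i = odds \o omega i); last first.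
  by apply/funext => w; exact: rE.
by apply: measurableT_comp => //; exact: rect_measurable_coord.
Qed.

Lemma measurable_rho i : measurable_fun setT (r i).
Proof. by apply: (rect_measurable_funP (@rect_measurable_rho setT i _)). Qed.

Lemma identical_rho i (A : set R) : measurable A ->
  P (r i @^-1` A) = P (r 0 @^-1` A).
Proof.
move=> mA; have [_ /(_ i 0 (odds @^-1` A))] := omega_iid.
have -> : r i = odds \o omega i by apply/funext => w; exact: rE.
have -> : r 0 = odds \o omega 0 by apply/funext => w; exact: rE.
by apply; rewrite -[X in measurable X]setTI; exact: measurable_odds.
Qed.

Lemma expectation_rho i (f : R -> R) : measurable_fun setT f ->
  (forall x, 0 <= f x) ->
  (\int[P]_w (f (r i w))%:E = \int[P]_w (f (r 0 w))%:E)%E.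
Proof.
move=> mf f0.
have E j : (\int[P]_w (f (r j w))%:E =
    \int[distribution P (omega j)]_x (f (odds x))%:E)%E.
  rewrite ge0_integral_distribution//.
  - by apply: eq_integral => w _ /=; rewrite rE.
  - by apply/measurable_EFinP; exact: measurableT_comp.
  - by move=> x; rewrite lee_fin.
rewrite !E; apply: eq_measure_integral => A mA _.
by have [_] := omega_iid; apply.
Qed.

Definition rho_moment (s : R) : \bar R := \int[P]_w (r 0 w `^ s)%:E.

Hypothesis Elnrho : ('E_P[fun w => ln (r 0 w)] < 0)%E.

(** The strict weighted mean inequality, integrated. The gap is carried as a summand [D] since the
    moment of order [s'] may be infinite and cannot be subtracted. The choice [s' = kappa] gives
    moments below 1, the choice [s = kappa] moments above 1. *)
Lemma rho_moment_convex s s' : 0 < s -> s < s' ->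
  exists2 D : \bar R, (0 < D)%E &
    (rho_moment s + D = (1 - s / s')%:E + (s / s')%:E * rho_moment s')%E.
Proof.
move=> s0 ss'; have s'0 : 0 < s' by exact: lt_trans ss'.
have t0 : 0 < s / s' by rewrite divr_gt0.
have t1 : s / s' < 1 by rewrite ltr_pdivrMr// mul1r.
have mpow u : measurable_fun setT (fun w => r 0 w `^ u).
  by apply: (measurableT_comp (measurable_powR u)); exact: measurable_rho.
pose D w := 1 - s / s' + s / s' * r 0 w `^ s' - r 0 w `^ s.
have D0 w : 0 <= D w.
  rewrite subr_ge0; have [->|r1] := eqVneq (r 0 w) 1; first by rewrite !powR1; lra.
  exact/ltW/powR_weighted_mean.
have mD : measurable_fun setT D.
  apply: measurable_funB => //; apply: measurable_funD; first exact: measurable_cst.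
  by apply: measurable_funM => //; exact: measurable_cst.
exists (\int[P]_w (D w)%:E)%E.
  rewrite lt_neqAle integral_ge0 ?andbT; last by move=> w _; rewrite lee_fin.
  apply/negP => /eqP/esym ID.
  (* A zero gap would force [rho_0 = 1] almost surely, hence [E ln rho_0 = 0]. *)
  have : ae_eq P setT (EFin \o D) (cst 0).
    apply/(ae_eq_integral_abs P measurableT); first exact/measurable_EFinP.
    by rewrite -[RHS]ID; apply: eq_integral => w _ /=; rewrite ger0_norm.
  move=> D_ae; move: Elnrho; rewrite unlock.
  rewrite (@ae_eq_integral _ _ _ P setT (cst 0%E))// ?integral0 ?ltxx//.
    apply/measurable_EFinP; apply: (measurableT_comp (@measurable_ln R)).
    exact: measurable_rho.
  apply: filterS D_ae => w /(_ I) /= [Dw] _.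
  have [->|r1] := eqVneq (r 0 w) 1; first by rewrite ln1.
  have := powR_weighted_mean (r_gt0 0 w) r1 s0 ss'.
  by rewrite -subr_gt0 -/(D w) Dw ltxx.
rewrite /rho_moment -ge0_integralD//; last 4 first.
- by move=> w _; rewrite lee_fin powR_ge0.
- exact/measurable_EFinP.
- by move=> w _; rewrite lee_fin.
- exact/measurable_EFinP.
rewrite -ge0_integralZl//; last 3 first.
- exact/measurable_EFinP.
- by move=> w _; rewrite lee_fin powR_ge0.
- by rewrite lee_fin ltW.
have <- : (\int[P]__ (1 - s / s')%:E = (1 - s / s')%:E)%E.
  by rewrite integral_cst// [X in (_ * X)%E]probability_setT mule1.
rewrite -ge0_integralD//; last 3 first.
- by move=> w _; rewrite lee_fin subr_ge0 ltW.
- by move=> w _; rewrite mule_ge0// lee_fin ?powR_ge0// ltW.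
- by apply: emeasurable_funM; [exact: measurable_cst | exact/measurable_EFinP].
by apply: eq_integral => w _; rewrite -EFinM -!EFinD; congr (_ %:E); rewrite /D; ring.
Qed.

Variable kappa : R.
Hypothesis kappa_gt0 : 0 < kappa.
Hypothesis kappa_moment : rho_moment kappa = 1%E.

Lemma rho_moment_lt1 s : 0 < s -> s < kappa -> (rho_moment s < 1)%E.
Proof.
move=> s0 sk; have [D D0] := rho_moment_convex s0 sk.
rewrite kappa_moment mule1 -EFinD subrK => DE.
rewrite -DE lteDl// fin_numElt; apply/andP; split.
  by apply: (@lt_le_trans _ _ 0%E) => //; apply: integral_ge0 => w _; rewrite lee_fin powR_ge0.
have : (rho_moment s <= 1)%E by rewrite -DE leeDl// ltW.
by move=> /le_lt_trans; apply; rewrite ltry.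
Qed.

Lemma rho_moment_gt1 s : kappa < s -> (1 < rho_moment s)%E.
Proof.
move=> ks; have s0 : 0 < s by exact: lt_trans ks.
have [D D0] := rho_moment_convex kappa_gt0 ks; rewrite kappa_moment => DE.
rewrite ltNge; apply/negP => le1.
have : (1 + D <= 1)%E.
  rewrite DE; apply: (@le_trans _ _ ((1 - kappa / s)%:E + (kappa / s)%:E * 1)%E).
    by rewrite leeD2l// lee_wpmul2l// lee_fin divr_ge0// ltW.
  by rewrite mule1 -EFinD subrK.
by apply/negP; rewrite -ltNge lteDl.
Qed.

End environment.
Lemma powR_subadditive (R : realType) (r a b : R) : 0 < r <= 1 -> 0 <= a -> 0 <= b ->
  (a + b) `^ r <= a `^ r + b `^ r.
Proof.
move=> /andP[r0 r1] a0 b0; have [s0|s0] := leP (a + b) 0.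
  have [-> ->] : a = 0 /\ b = 0 by lra.
  by rewrite addr0 powR0 ?gt_eqF// addr0.
(* A ratio in [[0, 1]] is at most its [r]-th power; the ratios of [a] and [b] to their sum add up to
   1. *)
have key c : 0 <= c -> c <= a + b -> c / (a + b) * (a + b) `^ r <= c `^ r.
  rewrite le_eqVlt => /predU1P[<- _|c0 cs]; first by rewrite mul0r mul0r powR_ge0.
  rewrite -{2}(divfK (lt0r_neq0 s0) c) powRM;
    [|exact: divr_ge0 (ltW c0) (ltW s0)|exact: ltW].
  rewrite ler_wpM2r ?powR_ge0//; apply: ger1_powR => //.
  by rewrite divr_gt0//= ler_pdivrMr// mul1r.
have := key a a0; have := key b b0; rewrite lerDl lerDr => /(_ a0) kb /(_ b0) ka.
apply: le_trans (lerD ka kb); rewrite -mulrDl -mulrDl divff ?mul1r//.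
by rewrite gt_eqF.
Qed.

Lemma powR_sum_le (R : realType) (r : R) (x : nat -> R) n : 0 < r <= 1 ->
  (forall i, 0 <= x i) ->
  (\sum_(i < n) x i) `^ r <= \sum_(i < n) x i `^ r.
Proof.
move=> r01 x0; elim: n => [|n IH].
  by rewrite !big_ord0 powR0// gt_eqF//; case/andP: r01.
rewrite !big_ord_recr /=; apply: le_trans (powR_subadditive r01 _ _) _ => //.
  exact: sumr_ge0.
by rewrite lerD2r.
Qed.

Lemma geometric_sum_le (R : realType) (q : R) N : 0 <= q < 1 ->
  \sum_(i < N) q ^+ i <= (1 - q)^-1.
Proof.
move=> /andP[q0 q1]; have := subrX1 q N.
move=> E; have {}E : (1 - q) * \sum_(i < N) q ^+ i = 1 - q ^+ N by rewrite -opprB mulNr -E opprB.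
rewrite -[leRHS]mul1r ler_pdivlMr ?subr_gt0// mulrC E.
by rewrite gerBl exprn_ge0.
Qed.

(** * Almost sure bounds from bounded means *)

Section bounded_means.
Context d (T : measurableType d) (R : realType) (P : probability T R).

(** By monotone convergence the pointwise limit is integrable, hence finite almost everywhere. *)
Lemma ae_bounded (Y : nat -> T -> R) (K : R) :
  (forall N, measurable_fun setT (Y N)) -> (forall N w, 0 <= Y N w) ->
  (forall w, nondecreasing_seq (Y ^~ w)) ->
  (forall N, (\int[P]_w (Y N w)%:E <= K%:E)%E) ->
  {ae P, forall w, exists C, forall N, Y N w <= C}.
Proof.
move=> mY Y0 ndY YK.
pose g N w := (Y N w)%:E.
have mg N : measurable_fun setT (g N) by exact/measurable_EFinP.
have g0 N w : setT w -> (0 <= g N w)%E by rewrite lee_fin.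
have ndg w : setT w -> nondecreasing_seq (g ^~ w).
  by move=> _ m n mn; rewrite lee_fin; exact: ndY.
have L0 w : (0 <= limn (g ^~ w))%E.
  apply: lime_ge; first exact: ereal_nondecreasing_is_cvgn (ndg w I).
  by apply: nearW => n; exact: g0.
have mL : measurable_fun setT (fun w => limn (g ^~ w)).
  apply: (emeasurable_fun_cvg g) => // w _.
  exact: ereal_nondecreasing_is_cvgn (ndg w I).
have iL : P.-integrable setT (fun w => limn (g ^~ w)).
  apply/integrableP; split => //.
  under eq_integral do rewrite gee0_abs//.
  rewrite monotone_convergence//; apply: le_lt_trans (ltry K).
  apply: lime_le; last by apply: nearW => n; exact: YK.
  apply: ereal_nondecreasing_is_cvgn => m n mn; apply: ge0_le_integral => //.
    by move=> w _; exact: g0.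
  by move=> w _; exact: ndg.
have := integrable_ae measurableT iL; apply: filterS => w /(_ I) Lw.
exists (fine (limn (g ^~ w))) => N; rewrite -lee_fin fineK//.
by have /cvg_lim -> // := ereal_nondecreasing_cvgn (ndg w I);
  apply: ereal_sup_ubound; exists N.
Qed.

(** The constant must be uniform in the cutoff [j], so that the bound survives the limit in [j]. The
    auxiliary sequence therefore raises the cutoff together with the number of dyadic scales. *)
Lemma ae_polynomial_bound (Z : nat -> nat -> T -> R) (K r eps : R) :
  0 < r <= 1 -> 0 < eps ->
  (forall j k, measurable_fun setT (Z j k)) -> (forall j k w, 0 <= Z j k w) ->
  (forall k w, nondecreasing_seq (fun j => Z j k w)) ->
  (forall j k, (\int[P]_w (Z j k w `^ r)%:E <= K%:E)%E) ->
  {ae P, forall w, exists C, forall n j, (0 < n)%N ->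
    \sum_(k < n) Z j k w <= C * n%:R `^ ((1 + eps) / r)}.
Proof.
move=> r01 eps0 mZ Z0 ndZ ZK; have /andP[r0 r1] := r01.
pose q : R := 2 `^ (- eps).
have q0 : 0 < q by rewrite powR_gt0.
have q1 : q < 1.
  by rewrite /q powRN invf_lt1 ?powR_gt0// -[ltLHS](powRr0 2) /powR gt_eqF// ltr_expR mul0r mulr_gt0// ln_gt0// ltr1n.
(* Y below is bounded in mean because E[S N i] <= 2^i K; its boundedness
   controls the sums at the dyadic times 2^i. *)
pose S N i w := \sum_(k < 2 ^ i) Z N k w `^ r.
pose Y N w := \sum_(i < N) q ^+ i / 2 ^+ i * S N i w.
have mpow N k : measurable_fun setT (fun w => Z N k w `^ r).
  exact: measurableT_comp (measurable_powR r) (mZ N k).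
have mS N i : measurable_fun setT (S N i) by exact: measurable_sum.
have S0 N i w : 0 <= S N i w by apply: sumr_ge0 => k _; exact: powR_ge0.
have c0 i : 0 <= q ^+ i / 2 ^+ i by rewrite divr_ge0 ?exprn_ge0// ltW.
have ndS i w : nondecreasing_seq (fun N => S N i w).
  move=> m n mn; apply: ler_sum => k _; apply: ge0_ler_powR; rewrite ?nnegrE//; first exact: ltW.
  exact: ndZ.
have : {ae P, forall w, exists C, forall N, Y N w <= C}.
  apply: (@ae_bounded _ ((1 - q)^-1 * K)).
  - move=> N; apply: measurable_sum => i; apply: measurable_funM.
      exact: measurable_cst.
    exact: mS.
  - by move=> N w; apply: sumr_ge0 => i _; rewrite mulr_ge0.
  - move=> w; apply/nondecreasing_seqP => N.
    rewrite /Y big_ord_recr /= -[leLHS]addr0; apply: lerD; last by rewrite mulr_ge0.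
    by apply: ler_sum => i _; rewrite ler_wpM2l// ndS.
  move=> N; have K0 : 0 <= K.
    rewrite -lee_fin; apply: le_trans (ZK 0%N 0%N).
    by apply: integral_ge0 => w _; rewrite lee_fin powR_ge0.
  have SK i : (\int[P]_w (q ^+ i / 2 ^+ i * S N i w)%:E <= (q ^+ i * K)%:E)%E.
    under eq_integral do rewrite EFinM.
    rewrite ge0_integralZl//; last 3 first.
    - exact/measurable_EFinP.
    - by move=> w _; rewrite lee_fin.
    - by rewrite lee_fin.
    apply: (@le_trans _ _ ((q ^+ i / 2 ^+ i)%:E * (2 ^+ i * K)%:E)%E).
      rewrite lee_wpmul2l ?lee_fin//.
      under eq_integral do rewrite -sumEFin.
      rewrite ge0_integral_sum//; last 2 first.
      - by move=> k; exact/measurable_EFinP.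
      - by move=> k w _; rewrite lee_fin powR_ge0.
      apply: (@le_trans _ _ (\sum_(k < 2 ^ i) K%:E)%E).
        by apply: lee_sum => k _; exact: ZK.
      by rewrite sumEFin sumr_const card_ord lee_fin -(mulr_natl K) natrX.
    by rewrite -EFinM lee_fin mulrA divfK// expf_neq0.
  rewrite /Y; under eq_integral do rewrite -sumEFin.
  rewrite ge0_integral_sum//; last 2 first.
  - by move=> i; apply/measurable_EFinP/measurable_funM; [exact: measurable_cst|exact: mS].
  - by move=> i w _; rewrite lee_fin mulr_ge0.
  apply: (@le_trans _ _ (\sum_(i < N) (q ^+ i * K)%:E)%E).
    by apply: lee_sum => i _; exact: SK.
  rewrite sumEFin -mulr_suml lee_fin ler_wpM2r//.
  by apply: geometric_sum_le; rewrite q1 ltW.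
apply: filterS => w [C HC].
have C0 : 0 <= C by apply: le_trans (HC 0%N); rewrite /Y big_ord0.
exists ((C * 2 `^ (1 + eps)) `^ r^-1) => n j n0.
have [i ni ni'] : exists2 i, (n <= 2 ^ i)%N & (2 ^ i <= 2 * n)%N.
  exists (up_log 2 n); first exact: up_logP.
  case: (n) n0 => // -[//|m] _; apply: leq_trans (_ : (2 * 2 ^ (up_log 2 m.+2).-1 <= _)%N).
    by rewrite -expnS prednK// up_log_gt0.
  by rewrite leq_mul2l /= ltnW// up_log_gtn.
(* At least [j], so that [Z N] dominates [Z j], and at least [i.+1], so that scale [i] occurs in
   [Y N]. *)
pose N := maxn j i.+1.
have step : (\sum_(k < n) Z j k w) `^ r <= C * (2 * n%:R) `^ (1 + eps).
  apply: le_trans (@powR_sum_le _ r (fun k => Z j k w) n r01 _) _ => //.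
  apply: (@le_trans _ _ (S N i w)).
    apply: (@le_trans _ _ (\sum_(k < n) Z N k w `^ r)).
      apply: ler_sum => k _; apply: ge0_ler_powR; rewrite ?nnegrE//; first exact: ltW.
      by apply: ndZ; exact: leq_maxl.
    rewrite /S -!(big_mkord predT (fun k => Z N k w `^ r)).
    rewrite (@big_cat_nat _ _ _ n 0 (2 ^ i)%N)//= lerDl.
    by apply: sumr_ge0 => k _; exact: powR_ge0.
  have iN : (i < N)%N by exact: leq_maxr.
  have : q ^+ i / 2 ^+ i * S N i w <= C.
    apply: le_trans (HC N); rewrite /Y (bigD1 (Ordinal iN))//= lerDl.
    by apply: sumr_ge0 => k _; rewrite mulr_ge0.
  rewrite -ler_pdivlMl ?divr_gt0 ?exprn_gt0// => /le_trans; apply.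
  rewrite mulrC ler_wpM2l// invf_div.
  have -> : 2 ^+ i / q ^+ i = (2 ^+ i) `^ (1 + eps) :> R.
    rewrite powRD; last by rewrite expf_neq0// implybT.
    rewrite powRr1 ?exprn_ge0//; congr (_ * _).
    rewrite -exprVn /q powRN invrK -(powR_mulrn i (powR_ge0 2 eps)).
    by rewrite -(powR_mulrn i (ler0n R 2)) -!powRrM mulrC.
  apply: ge0_ler_powR; rewrite ?nnegrE ?exprn_ge0 ?mulr_ge0//.
    by rewrite addr_ge0// ltW.
  by rewrite -natrX -natrM ler_nat.
have -> : \sum_(k < n) Z j k w = ((\sum_(k < n) Z j k w) `^ r) `^ r^-1.
  by rewrite -powRrM mulfV ?powRr1 ?sumr_ge0// gt_eqF.
apply: le_trans (ge0_ler_powR _ _ _ step) _; rewrite ?nnegrE ?powR_ge0 ?invr_ge0 ?mulr_ge0 ?powR_ge0//.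
  exact: ltW.
by rewrite powRM ?powR_ge0// mulrA powRM ?mulr_ge0 ?powR_ge0// -powRrM.
Qed.

End bounded_means.

(** * A calculus of mean bounds for functions of finitely or infinitely many sites *)

Section mean_bounds.
Context d (T : measurableType d) (R : realType) (P : probability T R).
Context (I : choiceType) (Y : I -> {RV P >-> R}).
Implicit Types (S : set I) (f g : T -> R).

(** Keeping track of the sites lets bounds be multiplied whenever the site sets are disjoint, as in
    the crossing recursions. *)
Definition mean_le S f (u : R) : Prop :=
  [/\ rect_measurable_fun Y S f, (forall w, 0 <= f w) &
      (\int[P]_w (f w)%:E <= u%:E)%E].

Lemma mean_le_ge0 S f u : mean_le S f u -> 0 <= u.
Proof.
move=> [_ f0 fu]; rewrite -lee_fin; apply: le_trans fu.
by apply: integral_ge0 => w _; rewrite lee_fin.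
Qed.

Lemma mean_leS S S' f u : S `<=` S' -> mean_le S f u -> mean_le S' f u.
Proof.
by move=> SS' [mf f0 fu]; split => //; exact: rect_measurable_funS mf.
Qed.

Lemma mean_le_cst S c : 0 <= c -> mean_le S (fun=> c) c.
Proof.
move=> c0; split => //; first exact: measurable_cst.
by rewrite integral_cst// [X in (_ * X)%E]probability_setT mule1.
Qed.

Lemma mean_leD S f g u v : mean_le S f u -> mean_le S g v ->
  mean_le S (fun w => f w + g w) (u + v).
Proof.
move=> [mf f0 fu] [mg g0 gv]; split; first exact: measurable_funD.
  by move=> w; rewrite addr_ge0.
under eq_integral do rewrite EFinD.
rewrite ge0_integralD//; first by rewrite EFinD leeD.
- by move=> w _; rewrite lee_fin.
- exact/measurable_EFinP/(rect_measurable_funP mf).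
- by move=> w _; rewrite lee_fin.
- exact/measurable_EFinP/(rect_measurable_funP mg).
Qed.

Lemma mean_le_le S f g u : rect_measurable_fun Y S f ->
  (forall w, 0 <= f w) -> (forall w, f w <= g w) -> mean_le S g u ->
  mean_le S f u.
Proof.
move=> mf f0 fg [mg g0 gu]; split => //; apply: le_trans gu.
apply: ge0_le_integral => //.
- by move=> w _; rewrite lee_fin.
- exact/measurable_EFinP/(rect_measurable_funP mf).
- exact/measurable_EFinP/(rect_measurable_funP mg).
- by move=> w _; rewrite lee_fin.
Qed.

Hypothesis iY : mutually_independent Y.

Lemma rect_expectationM S S' f g : S `&` S' = set0 ->
  rect_measurable_fun Y S f -> rect_measurable_fun Y S' g ->
  (forall w, 0 <= f w) -> (forall w, 0 <= g w) ->
  (\int[P]_w (f w * g w)%:E = (\int[P]_w (f w)%:E) * (\int[P]_w (g w)%:E))%E.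
Proof.
move=> SS' mf mg f0 g0.
pose F : {RV P >-> R} := HB.pack f (isMeasurableFun.Build _ _ _ _ _ (rect_measurable_funP mf)).
pose G : {RV P >-> R} := HB.pack g (isMeasurableFun.Build _ _ _ _ _ (rect_measurable_funP mg)).
apply: (@indep2_expectationM _ _ _ _ F G) => //.
exact: (rect_measurable_indep2 iY SS' mf mg).
Qed.

Lemma mean_leM S S' f g u v : S `&` S' = set0 ->
  mean_le S f u -> mean_le S' g v ->
  mean_le (S `|` S') (fun w => f w * g w) (u * v).
Proof.
move=> SS' [mf f0 fu] [mg g0 gv]; split.
- apply: measurable_funM; [apply: rect_measurable_funS mf|apply: rect_measurable_funS mg].
    exact: subsetUl.
  exact: subsetUr.
- by move=> w; rewrite mulr_ge0.
- rewrite (rect_expectationM SS')// EFinM lee_pmul//.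
    by apply: integral_ge0 => w _; rewrite lee_fin.
  by apply: integral_ge0 => w _; rewrite lee_fin.
Qed.

End mean_bounds.

(** * Bounds on the moments of crossing means and variances *)

Section crossing_moments.
Context (R : realType) (d : measure_display) (Omega : measurableType d).
Context (P : probability Omega R) (omega : int -> {RV P >-> R}).
Hypothesis omega_iid : iid omega.
Hypothesis omega01 : forall i w, 0 < omega i w < 1.

Let r (i : int) (w : Omega) : R := rho (omega ^~ w) i.
Let A j x w := cross_mean (omega ^~ w) j x.
Let B j x w := cross_var (omega ^~ w) j x.

Let e01 w i : 0 < omega i w < 1. Proof. exact: omega01. Qed.
Let r_ge0 i w : 0 <= r i w. Proof. exact/ltW/rho_gt0. Qed.
Let A_ge0 j x w : 0 <= A j x w. Proof. exact: cross_mean_ge0. Qed.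
Let B_ge0 j x w : 0 <= B j x w. Proof. exact: cross_var_ge0. Qed.

Let past (x : int) : set int := [set i | i <= x].

Let past_site x : [set x] `&` past (x - 1) = set0.
Proof. by apply/seteqP; split=> i // [/= ->]; rewrite /past /=; lia. Qed.

Let past_step x : [set x] `|` past (x - 1) `<=` past x.
Proof. by move=> i [/= ->|]; rewrite /past /=; lia. Qed.

Let mr S i : S i -> rect_measurable_fun omega S (r i).
Proof. exact: rect_measurable_rho. Qed.

Let mA j x : rect_measurable_fun omega (past x) (A j x).
Proof.
elim: j x => [|j IH] x; first exact: measurable_cst.
apply: measurable_funD.
  by apply: measurable_funD; [exact: measurable_cst|apply: mr; rewrite /past /=].
apply: measurable_funM; first by apply: mr; rewrite /past /=.
by apply: rect_measurable_funS (IH _) => i; rewrite /past /=; lia.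
Qed.

Let mB j x : rect_measurable_fun omega (past x) (B j x).
Proof.
elim: j x => [|j IH] x; first exact: measurable_cst.
have mrx : rect_measurable_fun omega (past x) (r x) by apply: mr; rewrite /past /=.
have sub : past (x - 1) `<=` past x by move=> i; rewrite /past /=; lia.
apply: measurable_funD.
  by apply: measurable_funM => //; exact: (rect_measurable_funS sub (IH (x - 1))).
apply: measurable_funM.
  by apply: measurable_funM => //; apply: measurable_funD => //; exact: measurable_cst.
apply: measurable_funX; apply: measurable_funD; first exact: measurable_cst.
exact: (rect_measurable_funS sub (@mA j (x - 1))).
Qed.

Lemma measurable_cross_mean j x : measurable_fun setT (fun w => cross_mean (omega ^~ w) j x).
Proof. exact: (rect_measurable_funP (@mA j x)). Qed.

Lemma measurable_cross_var j x : measurable_fun setT (fun w => cross_var (omega ^~ w) j x).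
Proof. exact: (rect_measurable_funP (@mB j x)). Qed.

Let mpow S (f : Omega -> R) s : rect_measurable_fun omega S f ->
  rect_measurable_fun omega S (fun w => f w `^ s).
Proof. by move=> mf; exact: measurableT_comp (measurable_powR s) mf. Qed.

Variables (s q1 : R).
Hypothesis s01 : 0 < s <= 1.
Hypothesis q1E : rho_moment omega s = q1%:E.
Hypothesis q1_lt1 : q1 < 1.

Let s_gt0 : 0 < s. Proof. by case/andP: s01. Qed.

Let g x w := r x w `^ s.
Let a j x w := A j x w `^ s.

Let g_ge0 x w : 0 <= g x w. Proof. exact: powR_ge0. Qed.
Let a_ge0 j x w : 0 <= a j x w. Proof. exact: powR_ge0. Qed.

Let g_mean x : mean_le omega [set x] (g x) q1.
Proof.
split => //; first by apply: mpow; apply: mr.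
rewrite -q1E; have <- : (\int[P]_w (g x w)%:E = rho_moment omega s)%E.
  exact: (expectation_rho omega_iid omega01 x (measurable_powR s) (fun y => powR_ge0 y s)).
by [].
Qed.

Let q1_ge0 : 0 <= q1. Proof. exact: mean_le_ge0 (g_mean 0). Qed.

Let a_step j x w : a j.+1 x w <= 1 + g x w * (1 + a j (x - 1) w).
Proof.
rewrite /a; have -> : A j.+1 x w = 1 + r x w * (1 + A j (x - 1) w).
  by rewrite /A /= /r; ring.
apply: le_trans (powR_subadditive s01 _ _) _ => //.
  by apply: mulr_ge0 => //; apply: addr_ge0.
rewrite powR1 lerD2l powRM; [|by []|by apply: addr_ge0].
apply: ler_wpM2l; first exact: g_ge0.
by apply: le_trans (powR_subadditive s01 ler01 (A_ge0 j (x - 1) w)) _; rewrite powR1.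
Qed.

(** The fixed point of [K = 1 + q1 (1 + K)], the mean form of [a_step]; it is therefore preserved by
    induction on the depth. *)
Let K1 := (1 + q1) / (1 - q1).

Let q1_pos : 0 < 1 - q1. Proof. by rewrite subr_gt0. Qed.

Let K1_ge0 : 0 <= K1.
Proof. by apply: divr_ge0; [exact: addr_ge0 | exact: ltW]. Qed.

Let a_mean j x : mean_le omega (past x) (a j x) K1.
Proof.
elim: j x => [|j IH] x.
  apply: mean_le_le (mean_le_cst omega (past x) K1_ge0) => //; first by apply: mpow; exact: mA.
  by move=> w; rewrite /a /A /= powR0 ?gt_eqF.
have -> : K1 = 1 + q1 * (1 + K1) by rewrite /K1; field; rewrite gt_eqF.
apply: (@mean_le_le _ _ _ _ _ _ _ _ (fun w => 1 + g x w * (1 + a j (x - 1) w))) => //.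
- by apply: mpow; exact: mA.
- apply: mean_leD; first exact: mean_le_cst.
  apply: mean_leS (@past_step x) _; apply: mean_leM => //; first by case: omega_iid.
  by apply: mean_leD; [exact: mean_le_cst|exact: IH].
Qed.

Lemma cross_mean_moment : exists K, forall j x,
  (\int[P]_w (cross_mean (omega ^~ w) j x `^ s)%:E <= K%:E)%E.
Proof. by exists K1 => j x; have [] := a_mean j x. Qed.

Variable q2 : R.
Hypothesis q2E : rho_moment omega (2 * s) = q2%:E.
Hypothesis q2_lt1 : q2 < 1.

Let g2_mean x : mean_le omega [set x] (fun w => g x w ^+ 2) q2.
Proof.
split => //.
- by apply: measurable_funX; apply: mpow; apply: mr.
- by move=> w; rewrite sqr_ge0.
- rewrite -q2E; have <- : (\int[P]_w (g x w ^+ 2)%:E = rho_moment omega (2 * s))%E.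
    rewrite /rho_moment.
    rewrite -(expectation_rho omega_iid omega01 x (measurable_powR (2 * s)) (fun y => powR_ge0 y (2 * s))).
    by apply: eq_integral => w _; rewrite -powR_mulrn// -powRrM mulrC.
  by [].
Qed.

Let q2_ge0 : 0 <= q2. Proof. exact: mean_le_ge0 (g2_mean 0). Qed.

Let one_plus_sq j x u : mean_le omega (past x) (fun w => a j x w ^+ 2) u ->
  mean_le omega (past x) (fun w => (1 + a j x w) ^+ 2) (1 + (K1 + K1) + u).
Proof.
move=> au.
apply: (@mean_le_le _ _ _ _ _ _ _ _ (fun w => 1 + (a j x w + a j x w) + a j x w ^+ 2)) => //.
- by apply: measurable_funX; apply: measurable_funD; [exact: measurable_cst|by apply: mpow; exact: mA].
- by move=> w; rewrite sqr_ge0.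
- by move=> w; rewrite le_eqVlt; apply/orP; left; apply/eqP; ring.
- apply: mean_leD => //; apply: mean_leD; first exact: mean_le_cst.
  by apply: mean_leD; exact: a_mean.
Qed.

(** [K2] below is the fixed point of [K = L + q2 K], obtained by squaring [a_step] and taking
    means. *)
Let L := 1 + (q1 * (1 + K1) + q1 * (1 + K1)) + q2 * (1 + (K1 + K1)).
Let K2 := L / (1 - q2).

Let q2_pos : 0 < 1 - q2. Proof. by rewrite subr_gt0. Qed.

Let L_ge0 : 0 <= L.
Proof.
have h1 : 0 <= q1 * (1 + K1) by apply: mulr_ge0 => //; exact: addr_ge0.
apply: addr_ge0; first exact: addr_ge0 ler01 (addr_ge0 h1 h1).
exact: mulr_ge0 q2_ge0 (addr_ge0 ler01 (addr_ge0 K1_ge0 K1_ge0)).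
Qed.

Let K2_ge0 : 0 <= K2. Proof. by apply: divr_ge0 => //; exact: ltW. Qed.

(** This is the moment of order [2 s] of the crossing mean. As [2 s] may exceed 1, subadditivity is
    used at order [s] and the result squared. *)
Let a2_mean j x : mean_le omega (past x) (fun w => a j x w ^+ 2) K2.
Proof.
elim: j x => [|j IH] x.
  apply: mean_le_le (mean_le_cst omega (past x) K2_ge0) => //.
  - by apply: measurable_funX; apply: mpow; exact: mA.
  - by move=> w; rewrite sqr_ge0.
  - by move=> w; rewrite /a /A /= powR0 ?gt_eqF// expr0n.
have -> : K2 = 1 + (q1 * (1 + K1) + q1 * (1 + K1)) + q2 * (1 + (K1 + K1) + K2).
  rewrite /K2 /L; field; rewrite gt_eqF//.
apply: (@mean_le_le _ _ _ _ _ _ _ _ (fun w =>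
  1 + (g x w * (1 + a j (x - 1) w) + g x w * (1 + a j (x - 1) w)) +
  g x w ^+ 2 * (1 + a j (x - 1) w) ^+ 2)) => //.
- by apply: measurable_funX; apply: mpow; exact: mA.
- by move=> w; rewrite sqr_ge0.
- move=> w; apply: (@le_trans _ _ ((1 + g x w * (1 + a j (x - 1) w)) ^+ 2)).
    apply: lerXn2r; last exact: a_step.
      by rewrite nnegrE; exact: a_ge0.
    rewrite nnegrE; apply: addr_ge0 => //; apply: mulr_ge0; first exact: g_ge0.
    exact: addr_ge0 ler01 (a_ge0 j (x - 1) w).
  by rewrite le_eqVlt; apply/orP; left; apply/eqP; ring.
have H : mean_le omega (past x) (fun w => g x w * (1 + a j (x - 1) w)) (q1 * (1 + K1)).
  apply: mean_leS (@past_step x) _; apply: mean_leM => //; first by case: omega_iid.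
  by apply: mean_leD; [exact: mean_le_cst|exact: a_mean].
apply: mean_leD; first by apply: mean_leD; [exact: mean_le_cst|exact: mean_leD].
apply: mean_leS (@past_step x) _; apply: mean_leM => //; first by case: omega_iid.
exact: one_plus_sq.
Qed.

Let M := 1 + (K1 + K1) + K2.
(** The fixed point of [K = q1 K + (q1 + q2) M]: [M] bounds the mean of [(1 + a)^2], and [q1 + q2]
    that of [g + g^2], which dominates [(rho (1 + rho))^s]. *)
Let K3 := (q1 + q2) * M / (1 - q1).

Let K3_ge0 : 0 <= K3.
Proof.
apply: divr_ge0; last exact: ltW.
apply: mulr_ge0; first exact: addr_ge0.
exact: addr_ge0 (addr_ge0 ler01 (addr_ge0 K1_ge0 K1_ge0)) K2_ge0.
Qed.

Let b_mean j x : mean_le omega (past x) (fun w => B j x w `^ s) K3.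
Proof.
elim: j x => [|j IH] x.
  apply: mean_le_le (mean_le_cst omega (past x) K3_ge0) => //; first by apply: mpow; exact: mB.
  - by move=> w; exact: powR_ge0.
  - by move=> w; rewrite /B /= powR0 ?gt_eqF.
have -> : K3 = q1 * K3 + (q1 + q2) * M by rewrite /K3; field; rewrite gt_eqF.
apply: (@mean_le_le _ _ _ _ _ _ _ _ (fun w => g x w * B j (x - 1) w `^ s +
  (g x w + g x w ^+ 2) * (1 + a j (x - 1) w) ^+ 2)) => //.
- by apply: mpow; exact: mB.
- by move=> w; exact: powR_ge0.
- move=> w; rewrite /B /=.
  have A1 : 0 <= 1 + A j (x - 1) w by apply: addr_ge0.
  apply: le_trans (powR_subadditive s01 _ _) _.
  + exact: mulr_ge0 (r_ge0 x w) (B_ge0 j (x - 1) w).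
  + apply: mulr_ge0 (sqr_ge0 _); apply: mulr_ge0 (r_ge0 x w) _.
    exact: addr_ge0 ler01 (r_ge0 x w).
  have R1 : 0 <= 1 + r x w by apply: addr_ge0.
  rewrite powRM; [|exact: r_ge0|exact: B_ge0]; rewrite lerD2l.
  rewrite powRM; [|exact: mulr_ge0 (r_ge0 x w) R1|exact: sqr_ge0]; apply: ler_pM.
  + exact: powR_ge0.
  + exact: powR_ge0.
  + rewrite powRM; [|exact: r_ge0|exact: R1].
    have -> : g x w + g x w ^+ 2 = g x w * (1 + g x w) by ring.
    apply: ler_wpM2l; first exact: g_ge0.
    by apply: le_trans (powR_subadditive s01 ler01 (r_ge0 x w)) _; rewrite powR1.
  + rewrite expr2 powRM// expr2; apply: ler_pM; rewrite ?powR_ge0//.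
      by apply: le_trans (powR_subadditive s01 ler01 (A_ge0 j (x - 1) w)) _; rewrite powR1.
    by apply: le_trans (powR_subadditive s01 ler01 (A_ge0 j (x - 1) w)) _; rewrite powR1.
apply: mean_leD; apply: mean_leS (@past_step x) _; apply: mean_leM => //.
- by case: omega_iid.
- by case: omega_iid.
- by apply: mean_leD.
- exact: one_plus_sq.
Qed.

Lemma cross_var_moment : exists K, forall j x,
  (\int[P]_w (cross_var (omega ^~ w) j x `^ s)%:E <= K%:E)%E.
Proof. by exists K3 => j x; have [] := b_mean j x. Qed.

End crossing_moments.
(** * Lower bounds on the environment *)

Section lower_bounds.
Context (R : realType) (d : measure_display) (Omega : measurableType d).
Context (P : probability Omega R) (omega : int -> {RV P >-> R}).
Hypothesis omega_iid : iid omega.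
Hypothesis omega01 : forall i w, 0 < omega i w < 1.

Let r (i : int) (w : Omega) : R := rho (omega ^~ w) i.

Let e01 w i : 0 < omega i w < 1. Proof. exact: omega01. Qed.
Let r_gt0 i w : 0 < r i w. Proof. exact: rho_gt0. Qed.
Let r_ge0 i w : 0 <= r i w. Proof. exact: ltW. Qed.
Let omega_indep : mutually_independent omega. Proof. by case: omega_iid. Qed.

Let mr S i : S i -> rect_measurable_fun omega S (r i).
Proof. exact: rect_measurable_rho. Qed.

Let laplace : exists q, 0 < q < 1 /\
  forall i, mean_le omega [set i] (fun w => expR (- r i w)) q.
Proof.
have mexp S i : S i -> rect_measurable_fun omega S (fun w => expR (- r i w)).
  move=> Si; apply: (measurableT_comp (@measurable_expR R)).
  by apply: measurable_funN; exact: mr.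
have mexp' i : measurable_fun setT (fun w => (expR (- r i w))%:E).
  by apply/measurable_EFinP; exact: (rect_measurable_funP (@mexp setT i I)).
pose q0 := (\int[P]_w (expR (- r 0 w))%:E)%E.
pose D := (\int[P]_w (1 - expR (- r 0 w))%:E)%E.
have lt1 w : expR (- r 0 w) < 1 by rewrite -[ltRHS]expR0 ltr_expR oppr_lt0.
have mD : measurable_fun setT (fun w => (1 - expR (- r 0 w))%:E).
  apply/measurable_EFinP; apply: measurable_funB; first exact: measurable_cst.
  exact: (rect_measurable_funP (@mexp setT 0 I)).
have D0 : (0 < D)%E.
  rewrite lt_neqAle integral_ge0 ?andbT; last by move=> w _; rewrite lee_fin subr_ge0 ltW.
  apply/negP => /eqP/esym ID.
  have : ae_eq P setT (fun w => (1 - expR (- r 0 w))%:E) (cst 0%E).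
    apply/(ae_eq_integral_abs P measurableT) => //.
    by rewrite -[RHS]ID; apply: eq_integral => w _ /=; rewrite ger0_norm// subr_ge0 ltW.
  move=> H; have H1 : ae_eq P setT (cst (1%E : \bar R)) (cst 0%E).
    apply: filterS H => w /(_ I) [] /eqP.
    by rewrite subr_eq0 => /eqP E; have := lt1 w; rewrite -E ltxx.
  have := ae_eq_integral _ _ measurableT _ _ H1.
  rewrite integral_cst// integral0 [X in (_ * X)%E]probability_setT mule1.
  by move=> /(_ (measurable_cst _) (measurable_cst _)) => -[] /eqP; rewrite oner_eq0.
have E : (q0 + D = 1)%E.
  rewrite /q0 /D -ge0_integralD//; last first.
    by move=> w _; rewrite lee_fin subr_ge0 ltW.
  under eq_integral do rewrite -EFinD subrKC.
  by rewrite integral_cst// [X in (_ * X)%E]probability_setT mule1.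
have q0_ge0 : (0 <= q0)%E by apply: integral_ge0 => w _; rewrite lee_fin expR_ge0.
have [q1 q1E] : exists q1 : R, q0 = q1%:E.
  case: (q0) E q0_ge0 => [x| |] //; first by move=> _ _; exists x.
  by rewrite addye// gt_eqF// (lt_trans _ D0).
have q1_ge0 : 0 <= q1 by rewrite -lee_fin -q1E.
have q1_lt1 : q1 < 1.
  by rewrite -lte_fin -q1E -E lteDl ?D0// q1E.
(* The midpoint with 1 is positive as soon as [q1] is nonnegative. *)
exists ((1 + q1) / 2); split; first by lra.
move=> i; split => //; first exact: mexp.
have -> : (\int[P]_w (expR (- r i w))%:E = q0)%E.
  apply: (expectation_rho omega_iid omega01 i (f := fun x => expR (- x))).
    by apply: (measurableT_comp (@measurable_expR R)); exact: oppr_measurable.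
  by move=> x; exact: expR_ge0.
by rewrite q1E lee_fin; lra.
Qed.

(** Chernoff's method: [G n], the exponential of minus the sum, has mean at most [q^n]. For
    [q < p < 1] the sum of [G n / p^n] has bounded means, so [G n <= C p^n] almost surely;
    logarithms give slope [- ln p]. *)
Lemma rho_sum_lower : {ae P, forall w, exists c C, 0 < c /\
  forall n : nat, c * n%:R - C <= \sum_(k < n) rho (omega ^~ w) k%:Z}.
Proof.
have [q [/andP[q0 q1] Hq]] := laplace.
pose p := (1 + q) / 2; have p0 : 0 < p by rewrite /p; lra.
have p1 : p < 1 by rewrite /p; lra.
have qp : q < p by rewrite /p; lra.
pose G n w := \prod_(k < n) expR (- r k%:Z w).
have GE n w : G n w = expR (- \sum_(k < n) r k%:Z w).
  by rewrite /G -sumrN expR_sum.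
have mG n : mean_le omega [set i | i < n%:Z] (G n) (q ^+ n).
  elim: n => [|n IH].
    rewrite /G expr0 (_ : (fun w => _) = cst 1); first exact: mean_le_cst.
    by apply/funext => w; rewrite big_ord0.
  rewrite (_ : G n.+1 = fun w => G n w * expR (- r n%:Z w)); last first.
    by apply/funext => w; rewrite /G big_ord_recr.
  rewrite exprSr; apply: (@mean_leS _ _ _ _ _ _ ([set i | i < n%:Z] `|` [set n%:Z])).
    by move=> i [/=|/= ->]; lia.
  apply: mean_leM => //.
  by apply/seteqP; split=> i // [/= H1 H2]; move: H1; rewrite H2 ltxx.
have : {ae P, forall w, exists C, forall N, \sum_(n < N) p ^- n * G n w <= C}.
  apply: (@ae_bounded _ _ _ _ _ (1 - q / p)^-1).
  - move=> N; apply: measurable_sum => n; apply: measurable_funM; first exact: measurable_cst.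
    by have [/rect_measurable_funP] := mG n.
  - move=> N w; apply: sumr_ge0 => n _; rewrite mulr_ge0//.
      by rewrite invr_ge0 exprn_ge0// ltW.
    by rewrite GE expR_ge0.
  - move=> w; apply/nondecreasing_seqP => N; rewrite big_ord_recr /= lerDl mulr_ge0//.
      by rewrite invr_ge0 exprn_ge0// ltW.
    by rewrite GE expR_ge0.
  move=> N; have : mean_le omega setT (fun w => \sum_(n < N) p ^- n * G n w)
      (\sum_(n < N) (q / p) ^+ n).
    elim: N => [|N IH].
      rewrite big_ord0 (_ : (fun w => _) = cst 0); first exact: mean_le_cst.
      by apply/funext => w; rewrite big_ord0.
    rewrite big_ord_recr /= (_ : (fun w => _) = fun w =>
      \sum_(n < N) p ^- n * G n w + p ^- N * G N w); last first.
      by apply/funext => w; rewrite big_ord_recr.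
    apply: mean_leD => //.
    have -> : (q / p) ^+ N = p ^- N * q ^+ N by rewrite expr_div_n mulrC.
    apply: (@mean_leS _ _ _ _ _ _ (set0 `|` [set i | i < N%:Z])) => //.
    apply: (@mean_leM _ _ _ _ _ _ omega_indep _ _ (fun=> p ^- N) (G N)) => //.
      by rewrite set0I.
    by apply: mean_le_cst; rewrite invr_ge0 exprn_ge0// ltW.
  move=> [_ _ /le_trans]; apply; rewrite lee_fin; apply: geometric_sum_le.
  by rewrite divr_ge0 ?ltW//= ltr_pdivrMr// mul1r.
apply: filterS => w [C HC].
exists (- ln p), (ln C); split; first by rewrite oppr_gt0 ln_lt0// p0.
move=> n; have : p ^- n * G n w <= C.
  apply: le_trans (HC n.+1); rewrite big_ord_recr /= lerDr.
  apply: sumr_ge0 => k _; rewrite mulr_ge0//; first by rewrite invr_ge0 exprn_ge0// ltW.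
  by rewrite GE expR_ge0.
rewrite GE mulrC ler_pdivrMr ?exprn_gt0// => H.
have C0 : 0 < C.
  by rewrite -(pmulr_lgt0 _ (exprn_gt0 n p0)); apply: lt_le_trans H; exact: expR_gt0.
have := H; rewrite -ler_ln ?posrE ?expR_gt0 ?mulr_gt0 ?exprn_gt0//.
rewrite expRK lnM ?posrE ?exprn_gt0// lnXn// -mulr_natl.
rewrite /r; lra.
Qed.

End lower_bounds.
Lemma bernoulli_inequality (R : realType) (c : R) n : 1 <= c -> 1 + n%:R * (c - 1) <= c ^+ n.
Proof.
move=> c1; elim: n => [|n IH]; first by rewrite mul0r addr0 expr0.
rewrite exprS; apply: le_trans (ler_wpM2l _ IH); last by rewrite (le_trans _ c1).
rewrite -natr1; have : 0 <= n%:R * (c - 1) * (c - 1) by rewrite !mulr_ge0// subr_ge0.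
lra.
Qed.

(** * Heavy tails of products over blocks of sites *)

Section blocks.
Context (R : realType) (d : measure_display) (Omega : measurableType d).
Context (P : probability Omega R) (omega : int -> {RV P >-> R}).
Hypothesis omega_iid : iid omega.
Hypothesis omega01 : forall i w, 0 < omega i w < 1.

Let r (i : int) (w : Omega) : R := rho (omega ^~ w) i.

Let e01 w i : 0 < omega i w < 1. Proof. exact: omega01. Qed.
Let r_gt0 i w : 0 < r i w. Proof. exact: rho_gt0. Qed.
Let omega_indep : mutually_independent omega. Proof. by case: omega_iid. Qed.

Let mr S i : S i -> rect_measurable_fun omega S (r i).
Proof. exact: rect_measurable_rho. Qed.

Definition block_prod (x : int) (m : nat) (w : Omega) : R :=
  \prod_(i < m) rho (omega ^~ w) (x - i%:Z).

Let window (x : int) (m : nat) : set int := [set i | x - m%:Z < i <= x].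

Lemma block_prod_gt0 x m w : 0 < block_prod x m w.
Proof. by apply: prodr_gt0 => i _; exact: r_gt0. Qed.

Lemma block_prodD x m n w :
  block_prod x (m + n) w = block_prod x m w * block_prod (x - m%:Z) n w.
Proof.
rewrite /block_prod big_split_ord; congr (_ * _); apply: eq_bigr => i _ /=.
by congr rho; lia.
Qed.

Lemma block_prodS x m w :
  block_prod x m.+1 w = r x w * block_prod (x - 1) m w.
Proof. by rewrite -add1n block_prodD /block_prod big_ord1 subr0. Qed.

Lemma measurable_block_prod x m :
  rect_measurable_fun omega [set i | x - m%:Z < i <= x] (block_prod x m).
Proof.
have H S : window x m `<=` S -> rect_measurable_fun omega S (block_prod x m).
  move=> wS; rewrite /rect_measurable_fun /block_prod.
  apply: measurable_prod => i _; apply: mr; apply: wS.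
  by rewrite /window /=; have := ltn_ord i; lia.
exact: H.
Qed.

Let mblockT x m : measurable_fun setT (block_prod x m).
Proof. exact: (rect_measurable_funP (@measurable_block_prod x m)). Qed.

Let mrT x : measurable_fun setT (r x).
Proof. exact: (rect_measurable_funP (@mr setT x I)). Qed.

Let site_window x m : [set x] `&` window (x - 1) m = set0.
Proof. by apply/seteqP; split=> i // [/= ->]; rewrite /window /=; lia. Qed.

(** Translation invariance by induction on the length: the last site and the rest of the block are
    independent, so their marginal laws determine the law of the product. *)
Lemma block_prod_law x m (A : set R) : measurable A ->
  P (block_prod x m @^-1` A) = P (block_prod 0 m @^-1` A).
Proof.
elim: m x A => [|m IH] x A mA.
  by congr (P (_ @^-1` A)); apply/funext => w; rewrite /block_prod !big_ord0.
pose X y : {RV P >-> R} := HB.pack (r y) (isMeasurableFun.Build _ _ _ _ _ (mrT y)).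
pose Y y : {RV P >-> R} := HB.pack (block_prod y m) (isMeasurableFun.Build _ _ _ _ _ (mblockT y m)).
have ind y : indep2 P (X y) (Y (y - 1)).
  apply: (rect_measurable_indep2 omega_indep (site_window y m)).
    exact: mr.
  exact: measurable_block_prod.
pose E : set (R * R) := [set z | A (z.1 * z.2)].
have mE : measurable E.
  rewrite -[E]setTI; apply: (measurable_funM (measurable_fst) (measurable_snd)) => //.
have HE y : block_prod y m.+1 @^-1` A = [set w | E (X y w, Y (y - 1) w)].
  by apply/seteqP; split=> w /=; rewrite /E /= block_prodS.
rewrite !HE; apply: indep2_law => // B mB.
  exact: (identical_rho omega_iid omega01).
by rewrite /distribution /pushforward /= (IH (x - 1))// (IH (0 - 1)).
Qed.

(** A real minorant [c] is used because the moment of order [s] may be infinite. *)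
Lemma block_prod_moment_ge x m (s c : R) : 0 <= c ->
  (c%:E <= rho_moment omega s)%E ->
  ((c ^+ m)%:E <= \int[P]_w (block_prod x m w `^ s)%:E)%E.
Proof.
move=> c0 cs; elim: m x => [|m IH] x.
  under eq_integral do rewrite /block_prod big_ord0 powR1.
  by rewrite integral_cst// [X in (_ * X)%E]probability_setT mule1 expr0.
under eq_integral do rewrite block_prodS powRM ?ltW ?block_prod_gt0//.
rewrite (rect_expectationM omega_indep (site_window x m)); last 4 first.
- exact: measurableT_comp (measurable_powR s) (@mr [set x] x erefl).
- exact: measurableT_comp (measurable_powR s) (@measurable_block_prod (x - 1) m).
- by move=> w; exact: powR_ge0.
- by move=> w; exact: powR_ge0.
have E : (\int[P]_w (r x w `^ s)%:E = rho_moment omega s)%E.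
  exact: (expectation_rho omega_iid omega01 x (measurable_powR s) (fun y => powR_ge0 y s)).
rewrite [X in (_ <= X * _)%E]E exprS EFinM.
by apply: lee_pmul => //; rewrite lee_fin ?exprn_ge0.
Qed.

(** Dyadic layer-cake bound: [b^s <= 1 + sum_l 2^(s (l+1)) 1(b > 2^l)], where for [b > 1] the level
    with [2^l < b <= 2^(l+1)] already suffices. The tail bound makes the series geometric, with a
    constant independent of [m]. *)
Let tail_moment m (s : R) (p : R) : 0 < s -> 0 < p -> 2 `^ s * p < 1 ->
  (forall l : nat, P [set w | (2 ^+ l < block_prod 0 m w)%R] <= (p ^+ l)%:E)%E ->
  (\int[P]_w (block_prod 0 m w `^ s)%:E <=
     (1 + 2 `^ s / (1 - 2 `^ s * p))%:E)%E.
Proof.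
move=> s0 p0 sp1 tail.
pose b := block_prod 0 m.
pose F l w := (2 `^ s) ^+ l.+1 * \1_[set w | 2 ^+ l < b w] w.
have t0 : 0 < 2 `^ s :> R by rewrite powR_gt0.
have mlev (l : nat) : measurable [set w | 2 ^+ l < b w].
  rewrite -[X in measurable X]setTI.
  exact: (measurable_fun_ltr (measurable_cst (2 ^+ l : R)) (mblockT 0 m)) => //.
have F0 l w : 0 <= F l w by rewrite mulr_ge0// exprn_ge0// ltW.
have mF l : measurable_fun setT (fun w => (F l w)%:E).
  apply/measurable_EFinP; apply: measurable_funM; first exact: measurable_cst.
  exact: measurable_indic.
have pointwise w : ((b w `^ s)%:E <= 1%:E + \sum_(l <oo) (F l w)%:E)%E.
  have b0 : 0 < b w by exact: block_prod_gt0.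
  have S0 : (0 <= \sum_(l <oo) (F l w)%:E)%E.
    by apply: nneseries_ge0 => l _ _; rewrite lee_fin.
  have [b1|b1] := leP (b w) 1.
    apply: (@le_trans _ _ 1%:E); last by rewrite leeDl.
    rewrite lee_fin -(powRr0 (b w)); apply: ger_powR; last exact: ltW.
    by rewrite b0.
  have ex : exists l, b w <= 2 ^+ l.
    exists (Num.bound (b w)); apply: ltW; apply: lt_le_trans (archi_boundP (ltW b0)) _.
    by rewrite -natrX ler_nat; exact/ltnW/ltn_expl.
  case: (ex_minnP ex) => -[|l] bl minl.
    by move: bl; rewrite expr0 leNgt b1.
  apply: (@le_trans _ _ (F l w)%:E).
    have bl' : 2 ^+ l < b w.
      by rewrite ltNge; apply/negP => /minl; rewrite ltnn.
    rewrite lee_fin /F indicE mem_set// mulr1.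
    have -> : (2 `^ s) ^+ l.+1 = (2 ^+ l.+1) `^ s :> R.
      by rewrite -(powR_mulrn l.+1 (powR_ge0 2 s)) -(powR_mulrn l.+1 (ler0n R 2)) -!powRrM mulrC.
    by apply: ge0_ler_powR; rewrite ?nnegrE ?exprn_ge0// ltW.
  apply: (@le_trans _ _ (\sum_(0 <= k < l.+1) (F k w)%:E)%E).
    rewrite big_nat_recr//= leeDr// sume_ge0// => k _; exact: F0.
  apply: le_trans (leeDr _ _); last by [].
  by apply: nneseries_lim_ge => k _ _; rewrite lee_fin.
apply: (@le_trans _ _ (\int[P]_w (1%:E + \sum_(l <oo) (F l w)%:E))%E).
  apply: ge0_le_integral => //.
  - by move=> w _; rewrite lee_fin powR_ge0.
  - apply/measurable_EFinP.
    exact: measurableT_comp (measurable_powR s) (mblockT 0 m).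
  - apply: emeasurable_funD; first exact: measurable_cst.
    by apply: ge0_emeasurable_sum => // l w _ _; rewrite lee_fin.
rewrite ge0_integralD//; last 2 first.
- by move=> w _; apply: nneseries_ge0 => l _ _; rewrite lee_fin.
- by apply: ge0_emeasurable_sum => // l w _ _; rewrite lee_fin.
rewrite integral_cst// [X in (_ * X)%E]probability_setT mule1 EFinD leeD2l//.
rewrite integral_nneseries//; last by move=> l w _; rewrite lee_fin.
have FE l : (\int[P]_w (F l w)%:E <= (2 `^ s * (2 `^ s * p) ^+ l)%:E)%E.
  rewrite /F; under eq_integral do rewrite EFinM.
  rewrite ge0_integralZl_EFin//; last by apply/measurable_EFinP; exact: measurable_indic.
  rewrite integral_indic// setIT.
  have -> : 2 `^ s * (2 `^ s * p) ^+ l = (2 `^ s) ^+ l.+1 * p ^+ l.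
    by rewrite exprMn exprS mulrA.
  rewrite EFinM; apply: lee_wpmul2l; last exact: tail.
  by rewrite lee_fin exprn_ge0// ltW.
apply: lime_le.
  by apply: is_cvg_nneseries => l _ _; apply: integral_ge0 => w _; rewrite lee_fin.
apply: nearW => N.
apply: (@le_trans _ _ (\sum_(0 <= l < N) (2 `^ s * (2 `^ s * p) ^+ l)%:E)%E).
  by apply: lee_sum => l _; exact: FE.
rewrite sumEFin lee_fin -mulr_sumr ler_wpM2l ?(ltW t0)// big_mkord.
apply: geometric_sum_le; rewrite sp1 andbT.
by apply: mulr_ge0; exact: ltW.
Qed.

Hypothesis Elnrho : ('E_P[fun w => ln (r 0 w)] < 0)%E.
Variable kappa : R.
Hypothesis kappa_gt0 : 0 < kappa.
Hypothesis kappa_moment : rho_moment omega kappa = 1%E.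

(* Otherwise E[(rho_1 ... rho_m)^s] would be bounded in m for kappa < s < gamma,
   whereas it is the m-th power of E[rho^s] > 1. *)
Lemma block_prod_tail gamma : kappa < gamma -> exists m l : nat, (0 < l)%N /\
  (((2 `^ (- gamma)) ^+ l)%:E <= P [set w | (2 ^+ l < block_prod 0 m w)%R])%E.
Proof.
move=> kg; apply: contrapT => /forallNP no.
pose p : R := 2 `^ (- gamma); pose s := (kappa + gamma) / 2.
have p0 : 0 < p by exact: powR_gt0.
have ks : kappa < s by rewrite /s; lra.
have s0 : 0 < s by exact: lt_trans ks.
have sp1 : 2 `^ s * p < 1.
  have -> : 2 `^ s * p = expR ((s - gamma) * ln 2).
    by rewrite /p /powR pnatr_eq0 -expRD; congr expR; ring.
  have l2 : 0 < ln 2 :> R by apply: ln_gt0; rewrite ltr1n.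
  rewrite -[ltRHS]expR0 ltr_expR nmulr_rlt0//; rewrite /s; lra.
(* At [l = 0] this is trivial, which is why the block can be required to have [l > 0] and so a
   threshold above 1. *)
have tail m (l : nat) : (P [set w | (2 ^+ l < block_prod 0 m w)%R] <= (p ^+ l)%:E)%E.
  case: l => [|l].
    rewrite expr0; apply: probability_le1; rewrite -[X in measurable X]setTI.
    exact: (measurable_fun_ltr (measurable_cst (1 : R)) (mblockT 0 m)) => //.
  rewrite leNgt; apply/negP => H; apply: (no m); exists l.+1; split=> //.
  exact: ltW.
have := rho_moment_gt1 omega01 Elnrho kappa_gt0 kappa_moment ks.
move=> gt1; have [c [c1 cs]] : exists c : R, 1 < c /\ (c%:E <= rho_moment omega s)%E.
  case E : (rho_moment omega s) gt1 => [c| |] //; first by exists c.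
  by exists 2; split; [rewrite ltr1n|rewrite leey].
pose K := 1 + 2 `^ s / (1 - 2 `^ s * p).
have cK n : c ^+ n <= K.
  rewrite -lee_fin; apply: le_trans (tail_moment s0 p0 sp1 (tail n)).
  by apply: block_prod_moment_ge => //; rewrite (le_trans _ (ltW c1)).
have := archi_boundP (_ : 0 <= K / (c - 1)).
set n := Num.bound _ => /(_ _).
have K0 : 0 <= K by apply: le_trans (cK 0%N); rewrite expr0.
rewrite divr_ge0 ?subr_ge0 ?(ltW c1)// => /(_ isT).
rewrite ltr_pdivrMr ?subr_gt0// => Kn.
have := le_trans (bernoulli_inequality n (ltW c1)) (cK n).
by move: Kn; lra.
Qed.

End blocks.

(** * Concatenated blocks and their first success *)

Section superblocks.
Context (R : realType) (d : measure_display) (Omega : measurableType d).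
Context (P : probability Omega R) (omega : int -> {RV P >-> R}).
Hypothesis omega_iid : iid omega.
Hypothesis omega01 : forall i w, 0 < omega i w < 1.
Variables (m : nat) (a B : R).
Hypothesis a_ge0 : 0 <= a.
Hypothesis B_gt0 : 0 < B.
Hypothesis tail : (a%:E <= P [set w | (B < block_prod omega 0 m w)%R])%E.

Let omega_indep : mutually_independent omega. Proof. by case: omega_iid. Qed.

Let measurable_gt (y : R) : measurable [set z : R | y < z].
Proof. by rewrite -set_itvoy; exact: measurable_itv. Qed.

Let measurable_ge (y : R) : measurable [set z : R | y <= z].
Proof. by rewrite -set_itvcy; exact: measurable_itv. Qed.

(** The [N] constituent blocks are independent and each exceeds [B] with probability at least [a].
    The weak inequality accommodates [N = 0], where both sides of the event equal 1. *)
Lemma superblock_probability N x :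
  ((a ^+ N)%:E <= P [set w | (B ^+ N <= block_prod omega x (N * m) w)%R])%E.
Proof.
elim: N x => [|N IH] x.
  rewrite expr0 (_ : [set w | _] = setT) ?probability_setT//.
  by apply/seteqP; split=> w // _; rewrite /= /block_prod mul0n big_ord0.
pose U := block_prod omega x m @^-1` [set z | B < z].
pose V := block_prod omega (x - m%:Z) (N * m) @^-1` [set z | B ^+ N <= z].
have UV : P (U `&` V) = (P U * P V)%E.
  have disj : [set i | x - m%:Z < i <= x] `&`
      [set i | x - m%:Z - (N * m)%N%:Z < i <= x - m%:Z] = set0.
    by apply/seteqP; split=> i // []; rewrite /=; lia.
  exact: (rect_measurable_indep2 omega_indep disj
    (measurable_block_prod omega01 (x := x) (m := m))
    (measurable_block_prod omega01 (x := x - m%:Z) (m := (N * m)%N))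
    (measurable_gt B) (measurable_ge (B ^+ N))).
apply: (@le_trans _ _ (P (U `&` V))).
  rewrite UV exprS EFinM; apply: lee_pmul; rewrite ?lee_fin ?exprn_ge0//.
    by rewrite block_prod_law.
  exact: IH.
have mX y n : measurable_fun setT (block_prod omega y n).
  exact: (rect_measurable_funP (measurable_block_prod omega01 (x := y) (m := n))).
have mpre y n (A : set R) : measurable A -> measurable (block_prod omega y n @^-1` A).
  by move=> mA; rewrite -[X in measurable X]setTI; exact: mX.
apply: le_measure; rewrite ?inE.
- by apply: measurableI; exact: mpre.
- exact: (mpre _ _ _ (measurable_ge _)).
- move=> w [/= Uw Vw]; rewrite mulSn block_prodD exprS.
  by apply: ler_pM => //; rewrite ?exprn_ge0// ltW.
Qed.

(** Superblock [b] occupies the sites from [b N m] to [(b + 1) N m - 1]; distinct superblocks are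
    disjoint and lie in the nonnegative half-line. *)
Let endpoint (N b : nat) : int := (b.+1 * (N * m))%N%:Z - 1.

Let failure (N b : nat) (w : Omega) : R :=
  \1_(block_prod omega (endpoint N b) (N * m) @^-1` [set z | z < B ^+ N]) w.

Let failures_mean (N J : nat) :
  mean_le omega [set i | i < (J * (N * m))%N%:Z]
    (fun w => \prod_(b < J) failure N b w) ((1 - a ^+ N) ^+ J).
Proof.
have one b : mean_le omega
    [set i | endpoint N b - (N * m)%N%:Z < i <= endpoint N b] (failure N b) (1 - a ^+ N).
  have mb := measurable_block_prod omega01 (x := endpoint N b) (m := (N * m)%N).
  have mlt : measurable [set z : R | z < B ^+ N].
    by rewrite -set_itvNyo; exact: measurable_itv.
  split=> //.
    apply: measurable_indic; have := mb measurableT _ mlt; rewrite setTI; exact.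
  have mpre (A : set R) : measurable A ->
      measurable (block_prod omega (endpoint N b) (N * m) @^-1` A).
    by move=> mA; rewrite -[X in measurable X]setTI; exact: (rect_measurable_funP mb).
  rewrite /failure integral_indic ?setIT//; last exact: mpre.
  have -> : block_prod omega (endpoint N b) (N * m) @^-1` [set z | z < B ^+ N] =
      ~` (block_prod omega (endpoint N b) (N * m) @^-1` [set z | B ^+ N <= z]).
    by apply/seteqP; split=> w /=; rewrite ltNge => /negP.
  rewrite [leLHS]probability_setC; last exact: (mpre _ (measurable_ge _)).
  by rewrite EFinB leeB// superblock_probability.
elim: J => [|J IH].
  rewrite expr0 (_ : (fun w => _) = cst 1); first exact: mean_le_cst.
  by apply/funext => w; rewrite big_ord0.
rewrite (_ : (fun w => _) = fun w => (\prod_(b < J) failure N b w) * failure N J w); last first.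
  by apply/funext => w; rewrite big_ord_recr.
rewrite exprSr; apply: (@mean_leS _ _ _ _ _ _ ([set i | i < (J * (N * m))%N%:Z] `|`
    [set i | endpoint N J - (N * m)%N%:Z < i <= endpoint N J])).
  move=> i; rewrite /endpoint /= mulSn => -[|]; lia.
apply: mean_leM => //.
by apply/seteqP; split=> i // []; rewrite /endpoint /= mulSn; lia.
Qed.

Hypothesis m_gt0 : (0 < m)%N.
Hypothesis a_gt0 : 0 < a.
Variable beta : R.
Hypothesis beta_gt1 : 1 < beta.

(** Enough superblocks for an expected number of successes of at least [beta^(2N)]; all of them fail
    with probability at most [exp(- beta^(2N)) <= beta^(-2N)]. *)
Definition superblock_count (N : nat) : nat := (Num.trunc ((beta ^+ 2 / a) ^+ N)).+1.

Let beta_gt0 : 0 < beta. Proof. by rewrite (lt_trans _ beta_gt1). Qed.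

Let a_le1 : a <= 1.
Proof.
rewrite -lee_fin; apply: le_trans tail _; apply: probability_le1.
rewrite -[X in measurable X]setTI.
exact: (rect_measurable_funP (measurable_block_prod omega01 (x := 0) (m := m)) measurableT (measurable_gt B)).
Qed.

Let failures_small N : (1 - a ^+ N) ^+ superblock_count N <= (beta ^+ N) ^- 2.
Proof.
have aN0 : 0 < a ^+ N by exact: exprn_gt0.
have aN1 : a ^+ N <= 1 by rewrite exprn_ile1// ltW.
have bN0 : 0 < (beta ^+ N) ^+ 2 by rewrite !exprn_gt0.
have count : (beta ^+ N) ^+ 2 <= (superblock_count N)%:R * a ^+ N.
  rewrite -ler_pdivrMr//; apply: le_trans (ltW (truncnS_gt _)).
  by rewrite expr_div_n -!exprM mulnC.
apply: (@le_trans _ _ (expR (- a ^+ N) ^+ superblock_count N)).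
  apply: lerXn2r; rewrite ?nnegrE ?expR_ge0 ?subr_ge0//.
  exact: expR_ge1Dx.
rewrite -expRM_natl mulrN expRN lef_pV2 ?posrE ?expR_gt0//.
apply: le_trans count _; apply: le_trans (expR_ge1Dx _).
by rewrite lerDr.
Qed.

(** With weight [beta^N], the indicator [G N] that all superblocks of size [N] fail has mean at most
    [beta^(-N)]. The weighted sums thus stay below some [C], and once [beta^N > C] the indicator
    cannot be 1. *)
Lemma superblock_success : {ae P, forall w, exists N0, forall N, (N0 < N)%N ->
  exists2 k : nat, (k < superblock_count N * (N * m))%N &
    B ^+ N <= block_prod omega k%:Z (N * m) w}.
Proof.
pose G N w := \prod_(b < superblock_count N) failure N b w.
have mG N : mean_le omega setT (fun w => beta ^+ N * G N w) (beta^-1 ^+ N).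
  have [mG G0 GE] := failures_mean N (superblock_count N).
  have -> : beta^-1 ^+ N = beta ^+ N * (beta ^+ N) ^- 2.
    by rewrite expr2 invfM mulrA divff ?mul1r ?exprVn// expf_neq0// gt_eqF.
  apply: (@mean_leS _ _ _ _ _ _ (set0 `|` [set i | i < (superblock_count N * (N * m))%N%:Z])) => //.
  apply: (@mean_leM _ _ _ _ _ _ omega_indep _ _ (fun=> beta ^+ N) (G N)).
  - by rewrite set0I.
  - by apply: mean_le_cst; rewrite exprn_ge0// ltW.
  - by split=> //; apply: le_trans GE _; rewrite lee_fin; exact: failures_small.
have G0 N w : 0 <= beta ^+ N * G N w by have [_ /(_ w)] := mG N.
have mS N : mean_le omega setT (fun w => \sum_(i < N) beta ^+ i * G i w)
    (\sum_(i < N) beta^-1 ^+ i).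
  elim: N => [|N IH].
    rewrite big_ord0 (_ : (fun w => _) = cst 0); first exact: mean_le_cst.
    by apply/funext => w; rewrite big_ord0.
  rewrite big_ord_recr /= (_ : (fun w => _) = fun w =>
    \sum_(i < N) beta ^+ i * G i w + beta ^+ N * G N w); last first.
    by apply/funext => w; rewrite big_ord_recr.
  exact: mean_leD.
have : {ae P, forall w, exists C, forall N, \sum_(i < N) beta ^+ i * G i w <= C}.
  apply: (@ae_bounded _ _ _ _ _ (1 - beta^-1)^-1).
  - by move=> N; have [/rect_measurable_funP] := mS N.
  - by move=> N w; have [_ /(_ w)] := mS N.
  - by move=> w; apply/nondecreasing_seqP => N; rewrite big_ord_recr /= lerDl.
  - move=> N; have [_ _ /le_trans] := mS N; apply; rewrite lee_fin.
    by apply: geometric_sum_le; rewrite invr_ge0 (ltW beta_gt0) invf_lt1.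
apply: filterS => w [C HC].
have C0 : 0 <= C by apply: le_trans (HC 0%N); rewrite big_ord0.
exists (Num.bound (C / (beta - 1))) => N N0.
have CN : C < beta ^+ N.
  have := archi_boundP (divr_ge0 C0 (_ : 0 <= beta - 1)).
  rewrite subr_ge0 => /(_ (ltW beta_gt1)); rewrite ltr_pdivrMr ?subr_gt0// => H.
  apply: lt_le_trans (bernoulli_inequality N (ltW beta_gt1)).
  have : (Num.bound (C / (beta - 1)))%:R * (beta - 1) <= N%:R * (beta - 1).
    by rewrite ler_wpM2r ?subr_ge0 ?(ltW beta_gt1)// ler_nat ltnW.
  by move: H; lra.
have GN : G N w != 1.
  apply/eqP => G1; have := HC N.+1; rewrite big_ord_recr /= G1 mulr1.
  have : 0 <= \sum_(i < N) beta ^+ i * G i w by apply: sumr_ge0.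
  by move: CN; lra.
have [b Hb] : exists b : 'I_(superblock_count N),
    B ^+ N <= block_prod omega (endpoint N b) (N * m) w.
  apply: contrapT => /forallNP no; move/eqP: GN; apply.
  rewrite /G big1// => b _; rewrite /failure indicE mem_set//=.
  by rewrite ltNge; apply/negP/no.
have Nm0 : (0 < N * m)%N by rewrite muln_gt0 m_gt0 andbT (leq_trans _ N0).
exists (b.+1 * (N * m)).-1.
  rewrite prednK; last by rewrite muln_gt0.
  by rewrite leq_mul2r ltn_ord orbT.
by rewrite predn_int// muln_gt0.
Qed.

End superblocks.

(** * The largest block product among the first [n] sites *)

Section maximal_block.
Context (R : realType) (d : measure_display) (Omega : measurableType d).
Context (P : probability Omega R) (omega : int -> {RV P >-> R}).
Hypothesis omega_iid : iid omega.
Hypothesis omega01 : forall i w, 0 < omega i w < 1.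
Hypothesis Elnrho : ('E_P[fun w => ln (rho (omega ^~ w) 0)] < 0)%E.
Variable kappa : R.
Hypothesis kappa_gt0 : 0 < kappa.
Hypothesis kappa_moment : rho_moment omega kappa = 1%E.

Lemma maximal_block_lower gamma : kappa < gamma ->
  {ae P, forall w, exists (c : R) n0, 0 < c /\ forall n, (n0 <= n)%N ->
    exists k m : nat, [/\ (k < n)%N, (0 < m)%N &
      c * n%:R `^ gamma^-1 <= block_prod omega k%:Z m w]}.
Proof.
move=> kg; pose g' := (kappa + gamma) / 2.
have kg' : kappa < g' by rewrite /g'; lra.
have g'0 : 0 < g' by exact: lt_trans kg'.
have gamma0 : 0 < gamma by exact: lt_trans kg.
have [m [l [l0 tail]]] := block_prod_tail omega_iid omega01 Elnrho kappa_gt0 kappa_moment kg'.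
pose B : R := 2 ^+ l.
have B1 : 1 < B by rewrite exprn_egt1 ?ltr1n// -lt0n.
have B0 : 0 < B by exact: lt_trans B1.
have lB : 0 < ln B by rewrite ln_gt0.
pose a : R := (2 `^ (- g')) ^+ l.
have aE : a = expR (- g' * ln B).
  by rewrite /a -powR_mulrn ?powR_ge0// -powRrM /powR pnatr_eq0 /= /B lnXn// -mulr_natl; congr expR; ring.
have a0 : 0 < a by rewrite aE expR_gt0.
have m0 : (0 < m)%N.
  rewrite lt0n; apply/eqP => m_eq0; move: tail; rewrite -/a -/B m_eq0.
  rewrite (_ : [set w | _] = set0) ?measure0 ?lee_fin ?leNgt ?a0//.
  by apply/seteqP; split=> w //=; rewrite /block_prod big_ord0 ltNge (ltW B1).
(* [a = B^(-g')], so this choice makes [beta^3 / a = B^gamma]: two factors [beta] come from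
   [superblock_count], and the third absorbs the length factor [N]. *)
pose beta : R := expR ((gamma - g') / 3 * ln B).
have lbeta : 0 < (gamma - g') / 3 * ln B by rewrite mulr_gt0// /g'; lra.
have beta1 : 1 < beta by rewrite /beta -[ltLHS]expR0 ltr_expR.
have := superblock_success omega_iid omega01 (ltW a0) B0 tail m0 a0 beta1.
apply: filterS => w [N0 HN].
pose C1 : R := 2 * m%:R / (beta - 1).
have C10 : 0 < C1 by rewrite divr_gt0 ?mulr_gt0 ?ltr0n// subr_gt0.
pose lD := gamma * ln B.
have lD0 : 0 < lD by rewrite mulr_gt0.
have size N : (superblock_count a beta N * (N * m))%:R <= C1 * expR (N%:R * lD).
  have DE : expR (N%:R * lD) = (beta ^+ 2 / a) ^+ N * beta ^+ N.
    rewrite -exprMn expRM_natl; congr (_ ^+ _).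
    rewrite aE -expRN /beta -expRM_natl -!expRD; congr expR.
    by rewrite /lD /g'; field.
  have ge1 : 1 <= (beta ^+ 2 / a) ^+ N.
    rewrite exprn_ege1// ler_pdivlMr// mul1r; apply: (@le_trans _ _ 1).
      rewrite aE -expR0 ler_expR; nra.
    by rewrite exprn_ege1// ltW.
  have c2 : (superblock_count a beta N)%:R <= 2 * (beta ^+ 2 / a) ^+ N.
    rewrite /superblock_count -natr1.
    have : (Num.trunc ((beta ^+ 2 / a) ^+ N))%:R <= (beta ^+ 2 / a) ^+ N.
      by rewrite truncn_le (le_trans _ ge1).
    by move: ge1; lra.
  have cN : N%:R <= beta ^+ N / (beta - 1).
    rewrite ler_pdivlMr ?subr_gt0//.
    by apply: le_trans (bernoulli_inequality N (ltW beta1)); rewrite lerDr.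
  rewrite !natrM DE /C1.
  have -> : 2 * m%:R / (beta - 1) * ((beta ^+ 2 / a) ^+ N * beta ^+ N) =
    (2 * (beta ^+ 2 / a) ^+ N) * (beta ^+ N / (beta - 1) * m%:R) by ring.
  by apply: ler_pM => //; rewrite ler_wpM2r.
(* The constant is [C1^(-1/gamma) / B]; the division by [B] pays for rounding [y] down to [N]. The
   threshold on [n] ensures [N > N0]. *)
exists (expR (- (ln C1 + lD) / gamma)), (Num.bound (C1 * expR (N0.+1%:R * lD))).
split; first exact: expR_gt0.
move=> n nn0.
have nlarge : C1 * expR (N0.+1%:R * lD) <= n%:R.
  apply: le_trans (ltW (archi_boundP _)) _; last by rewrite ler_nat.
  by rewrite mulr_ge0 ?(ltW C10)// expR_ge0.
have n0 : 0 < n%:R :> R by apply: lt_le_trans nlarge; rewrite mulr_gt0// expR_gt0.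
(* The real solution of [C1 B^(gamma y) = n]; with [N] its integer part, all superblocks of size [N]
   fit into the first [n] sites. *)
pose y := (ln n%:R - ln C1) / lD.
have nE : n%:R = C1 * expR (y * lD).
  by rewrite /y divfK ?gt_eqF// expRD expRN !lnK ?posrE// mulrC divfK// gt_eqF.
have yN0 : N0.+1%:R <= y.
  rewrite -(ler_pM2r lD0) -ler_expR -(ler_pM2l C10) -nE.
  exact: nlarge.
have y0 : 0 <= y by apply: le_trans yN0.
pose N := Num.trunc y.
have /andP[Ny yN] : N%:R <= y < N.+1%:R by exact: truncn_itv.
have NN0 : (N0 < N)%N.
  have : (N0.+1%:R : R) < N.+1%:R by apply: le_lt_trans yN.
  by rewrite ltr_nat ltnS.
have [k kN Bk] := HN N NN0.
exists k, (N * m)%N; split.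
- apply: leq_trans kN _; rewrite -(ler_nat R); apply: le_trans (size N) _.
  by rewrite nE ler_pM2l// ler_expR ler_pM2r.
- by rewrite muln_gt0 m0 andbT (leq_trans _ NN0).
- apply: le_trans Bk.
  have -> : B ^+ N = expR (N%:R * ln B) by rewrite expRM_natl lnK ?posrE.
  rewrite /powR gt_eqF// -expRD ler_expR.
  have -> : gamma^-1 * ln n%:R = (y * lD + ln C1) / gamma.
    by rewrite /y divfK ?gt_eqF// subrK mulrC.
  have -> : - (ln C1 + lD) / gamma + (y * lD + ln C1) / gamma = (y - 1) * ln B.
    by rewrite /lD; field; rewrite gt_eqF.
  by rewrite ler_pM2r// lerBlDr natr1 ltW.
Qed.

End maximal_block.
(** * Growth exponents *)

Section polynomial_growth.
Context (R : realType).

Lemma ln_ratio_cvg (V : nat -> R) (theta : R) :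
  (forall delta, 0 < delta -> exists C, forall n, (0 < n)%N ->
    V n <= C * n%:R `^ (theta + delta)) ->
  (forall delta, 0 < delta -> exists (c : R) n0, 0 < c /\
    forall n, (n0 <= n)%N -> c * n%:R `^ (theta - delta) <= V n) ->
  (lne (V n)%:E / (ln (n%:R : R))%:E)%E @[n --> \oo] --> theta%:E.
Proof.
move=> up lo.
(* Any single lower bound makes [V] eventually positive, so that [lne] is the real logarithm
   there. *)
have [c1 [n1 [c1_gt0 Hc1]]] := lo 1 ltr01.
have V_gt0 n : (n1 <= n)%N -> (0 < n)%N -> 0 < V n.
  move=> n1n n0; apply: lt_le_trans (Hc1 n n1n).
  by rewrite mulr_gt0// powR_gt0// ltr0n.
suff H : ln (V n) / ln (n%:R : R) @[n --> \oo] --> theta.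
  apply: (@cvg_trans _ ((ln (V n) / ln (n%:R : R))%:E @[n --> \oo])); last first.
    by apply: cvg_EFin => //; near=> n.
  apply: near_eq_cvg; near=> n.
  have n2 : (1 < n)%N by near: n; exact: nbhs_infty_gt.
  have n1n : (n1 <= n)%N by near: n; exact: nbhs_infty_ge.
  rewrite lne_EFin; last by apply: V_gt0 => //; exact: ltnW.
  by rewrite inver gt_eqF ?EFinM// ln_gt0// ltr1n.
apply/cvgrPdist_le => eps eps0.
have e2 : 0 < eps / 2 by rewrite divr_gt0.
have [C HC] := up _ e2; have [c [n0 [c0 Hc]]] := lo _ e2.
(* For [n >= e^K] the constants contribute at most [eps / 2] after division by [ln n]. *)
pose K := (`|ln C| + `|ln c|) / (eps / 2).
near=> n.
have n2 : (1 < n)%N by near: n; exact: nbhs_infty_gt.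
have n1n : (n1 <= n)%N by near: n; exact: nbhs_infty_ge.
have n0n : (n0 <= n)%N by near: n; exact: nbhs_infty_ge.
have nK : (Num.bound (expR K) <= n)%N by near: n; exact: nbhs_infty_ge.
have n_gt0 : 0 < n%:R :> R by rewrite ltr0n ltnW.
have ln0 : 0 < ln n%:R :> R by rewrite ln_gt0// ltr1n.
have Vn := V_gt0 n n1n (ltnW n2).
have lnK : `|ln C| + `|ln c| <= eps / 2 * ln n%:R.
  rewrite mulrC -ler_pdivrMr// -/K -ler_expR lnK ?posrE//.
  apply: le_trans (ltW (archi_boundP (expR_ge0 K))) _.
  by rewrite ler_nat.
have upn := HC n (ltnW n2); have lon := Hc n n0n.
have C0 : 0 < C.
  rewrite -(pmulr_lgt0 _ (powR_gt0 (theta + eps / 2) n_gt0)).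
  exact: lt_le_trans Vn upn.
have {}upn : ln (V n) <= ln C + (theta + eps / 2) * ln n%:R.
  rewrite -ln_powR -lnM ?posrE ?powR_gt0// ler_ln ?posrE ?mulr_gt0 ?powR_gt0//.
have {}lon : ln c + (theta - eps / 2) * ln n%:R <= ln (V n).
  rewrite -ln_powR -lnM ?posrE ?powR_gt0// ler_ln ?posrE ?mulr_gt0 ?powR_gt0//.
have aC := ler_norm (ln C); have ac := ler_norm (- ln c); rewrite normrN in ac.
have nC := normr_ge0 (ln C); have nc := normr_ge0 (ln c).
rewrite ler_norml; apply/andP; split.
  rewrite lerBrDl -lerBrDr opprK ler_pdivrMr//.
  by move: lnK upn; lra.
rewrite lerBlDr -lerBlDl ler_pdivlMr//.
by move: lnK lon; lra.
Unshelve. all: by end_near. Qed.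

End polynomial_growth.

(** * Polynomial bounds valid for almost every environment *)

Section environment_asymptotics.
Context (R : realType) (d : measure_display) (Omega : measurableType d).
Context (P : probability Omega R) (omega : int -> {RV P >-> R}).
Hypothesis omega_iid : iid omega.
Hypothesis omega01 : forall i w, 0 < omega i w < 1.
Hypothesis Elnrho : ('E_P[fun w => ln (rho (omega ^~ w) 0)] < 0)%E.
Variable kappa : R.
Hypothesis kappa_gt0 : 0 < kappa.
Hypothesis kappa_moment : rho_moment omega kappa = 1%E.

Let e01 w i : 0 < omega i w < 1. Proof. exact: omega01. Qed.

Let moment_lt1 s : 0 < s -> s < kappa ->
  exists2 q, rho_moment omega s = q%:E & q < 1.
Proof.
move=> s0 sk.
have := rho_moment_lt1 omega01 Elnrho kappa_moment s0 sk.
have : (0 <= rho_moment omega s)%E.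
  by apply: integral_ge0 => w _; rewrite lee_fin powR_ge0.
case: (rho_moment omega s) => [q| |] //.
by rewrite lte_fin => _ q1; exists q.
Qed.

(** The exceptional null set must not depend on [delta]: the countably many values [1 / (i + 1)]
    suffice by monotonicity. *)
Let ae_all_delta (F : R -> Omega -> Prop) :
  (forall delta delta' w, delta' <= delta -> F delta' w -> F delta w) ->
  (forall delta, 0 < delta -> {ae P, forall w, F delta w}) ->
  {ae P, forall w, forall delta, 0 < delta -> F delta w}.
Proof.
move=> mono H.
have : {ae P, forall w, forall i : nat, F i.+1%:R^-1 w}.
  by apply: ae_foralln => i; apply: H; rewrite invr_gt0 ltr0n.
apply: filterS => w Fw delta d0.
apply: mono (Fw (Num.bound delta^-1)).
have d0' : 0 <= delta^-1 by rewrite invr_ge0 ltW.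
rewrite invf_ple ?posrE ?ltr0n//.
by apply: le_trans (ltW (archi_boundP d0')) _; rewrite ler_nat.
Qed.

Let upper (Z : nat -> nat -> Omega -> R) (theta : R) : 1 <= theta ->
  (forall j k, measurable_fun setT (Z j k)) -> (forall j k w, 0 <= Z j k w) ->
  (forall k w, nondecreasing_seq (fun j => Z j k w)) ->
  (forall s, 0 < s <= 1 -> s * theta < 1 -> exists K, forall j k,
    (\int[P]_w (Z j k w `^ s)%:E <= K%:E)%E) ->
  {ae P, forall w, forall delta, 0 < delta -> exists C, forall n j, (0 < n)%N ->
    \sum_(k < n) Z j k w <= C * n%:R `^ (theta + delta)}.
Proof.
move=> theta1 mZ Z0 ndZ moments; apply: ae_all_delta.
  move=> delta delta' w dd [C HC]; exists C => n j n0.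
  apply: le_trans (HC n j n0) _.
  have C0 : 0 <= C.
    have := HC 1%N j (ltn0Sn 0); rewrite powR1 mulr1; apply: le_trans.
    by apply: sumr_ge0.
  by rewrite ler_wpM2l// ler_powR ?ler1n// lerD2l.
(* Half of [delta] brings [s] strictly below [1 / theta]; the other half becomes
   [eps = delta / 2 * s], so that [(1 + eps) / s = theta + delta]. *)
move=> delta d0; pose s := (theta + delta / 2)^-1.
have t0 : 0 < theta + delta / 2 by lra.
have s0 : 0 < s by rewrite invr_gt0.
have s1 : 0 < s <= 1 by rewrite s0 /= invf_le1//; lra.
have st : s * theta < 1 by rewrite mulrC ltr_pdivrMr//; lra.
have [K HK] := moments s s1 st.
have eps0 : 0 < delta / 2 * s by rewrite mulr_gt0// divr_gt0.
have := ae_polynomial_bound s1 eps0 mZ Z0 ndZ HK.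
have -> : (1 + delta / 2 * s) / s = theta + delta.
  by rewrite mulrDl mul1r mulfK ?gt_eqF// /s invrK; lra.
by [].
Qed.

Lemma sum_cross_mean_upper : {ae P, forall w, forall delta, 0 < delta ->
  exists C, forall n j, (0 < n)%N ->
  \sum_(k < n) cross_mean (omega ^~ w) j k%:Z <= C * n%:R `^ (Num.max (1 / kappa) 1 + delta)}.
Proof.
apply: (@upper (fun j k w => cross_mean (omega ^~ w) j k%:Z)).
- by rewrite le_max lexx orbT.
- by move=> j k; exact: measurable_cross_mean.
- by move=> j k w; exact: cross_mean_ge0.
- by move=> k w; exact: cross_mean_nd.
move=> s s01 st; have /andP[s0 _] := s01.
have sk : s < kappa.
  rewrite -[kappa]mul1r -ltr_pdivrMr//; apply: le_lt_trans st.
  by rewrite ler_wpM2l ?(ltW s0)// le_max div1r lexx.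
have [q qE q1] := moment_lt1 s0 sk.
have [K HK] := cross_mean_moment omega_iid omega01 s01 qE q1.
by exists K => j k; exact: HK.
Qed.

Lemma sum_cross_var_upper : {ae P, forall w, forall delta, 0 < delta ->
  exists C, forall n j, (0 < n)%N ->
  \sum_(k < n) cross_var (omega ^~ w) j k%:Z <= C * n%:R `^ (Num.max (2 / kappa) 1 + delta)}.
Proof.
apply: (@upper (fun j k w => cross_var (omega ^~ w) j k%:Z)).
- by rewrite le_max lexx orbT.
- by move=> j k; exact: measurable_cross_var.
- by move=> j k w; exact: cross_var_ge0.
- by move=> k w; exact: cross_var_nd.
move=> s s01 st; have /andP[s0 _] := s01.
have s2k : 2 * s < kappa.
  rewrite -[kappa]mul1r -ltr_pdivrMr//; apply: le_lt_trans st.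
  by rewrite mulrAC mulrC ler_wpM2l ?(ltW s0)// le_max lexx.
have sk : s < kappa by apply: le_lt_trans s2k; rewrite ler_peMl ?ler1n// ltW.
have s20 : 0 < 2 * s by rewrite mulr_gt0.
have [q qE q1] := moment_lt1 s0 sk; have [q' qE' q1'] := moment_lt1 s20 s2k.
have [K HK] := cross_var_moment omega_iid omega01 s01 qE q1 qE' q1'.
by exists K => j k; exact: HK.
Qed.

Lemma block_lower : {ae P, forall w, forall delta, 0 < delta ->
  exists (c : R) n0, 0 < c /\ forall n, (n0 <= n)%N -> exists k m : nat,
    [/\ (k < n)%N, (0 < m)%N &
      c * n%:R `^ (1 / kappa - delta) <= block_prod omega k%:Z m w]}.
Proof.
apply: ae_all_delta.
  move=> delta delta' w dd [c [n0 [c0 Hc]]]; exists c, n0.+1; split=> // n n0n.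
  have [k [m [kn m0 ckm]]] := Hc n (ltnW n0n); exists k, m; split=> //.
  apply: le_trans ckm; rewrite ler_wpM2l ?(ltW c0)// ler_powR ?ler1n ?(leq_trans _ n0n)//.
  by rewrite lerB.
(* Then [1 / gamma = (1 / kappa) / (1 + delta kappa)], which is at least [1 / kappa - delta]. *)
move=> delta d0; pose gamma := kappa + delta * kappa ^+ 2.
have kg : kappa < gamma by rewrite ltrDl mulr_gt0// exprn_gt0.
have := maximal_block_lower omega_iid omega01 Elnrho kappa_gt0 kappa_moment kg.
apply: filterS => w [c [n0 [c0 Hc]]]; exists c, n0.+1; split=> // n n0n.
have [k [m [kn m0 ckm]]] := Hc n (ltnW n0n); exists k, m; split=> //.
apply: le_trans ckm; rewrite ler_wpM2l ?(ltW c0)// ler_powR ?ler1n ?(leq_trans _ n0n)//.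
have -> : gamma^-1 = 1 / kappa / (1 + delta * kappa).
  by rewrite /gamma; field; rewrite !gt_eqF// ?addr_gt0 ?mulr_gt0 ?exprn_gt0.
have dk0 : 0 < 1 + delta * kappa by rewrite addr_gt0// mulr_gt0.
rewrite ler_pdivlMr//.
have -> : (1 / kappa - delta) * (1 + delta * kappa) = 1 / kappa - delta ^+ 2 * kappa.
  by field; rewrite gt_eqF.
by rewrite gerBl mulr_ge0 ?sqr_ge0// ltW.
Qed.

End environment_asymptotics.

(** * Exact quenched mean and variance in a fixed environment *)

Section quenched_moments.
Context (R : realType) d (T : measurableType d) (Q : probability T R).
Context (X : nat -> T -> int) (e : int -> R).
Hypothesis e01 : forall i, 0 < e i < 1.
Hypothesis walk : walk_in_environment Q X e.
Hypothesis mean_bounded : forall k : nat, exists C, forall j, cross_mean e j k%:Z <= C.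
Hypothesis var_bounded : forall k : nat, exists C, forall j, cross_var e j k%:Z <= C.

Let bounded_left := cross_bounded_left e01 mean_bounded var_bounded.

Let sum_rev (f : int -> R) n :
  \sum_(i < n) f (n%:Z - i.+1%:Z) = \sum_(k < n) f k%:Z.
Proof.
rewrite (reindex_inj rev_ord_inj) /=; apply: eq_bigr => i _.
by congr f; have := ltn_ord i; lia.
Qed.

Lemma quenched_mean_var n :
  expectatione Q (hitting_time R X n) = (\sum_(k < n) mean_lim e k%:Z)%:E /\
  variancee Q (hitting_time R X n) = (\sum_(k < n) var_lim e k%:Z)%:E.
Proof.
have bm x : exists C, forall j, cross_mean e j x <= C by have [] := bounded_left x.
have bv x : exists C, forall j, cross_var e j x <= C by have [] := bounded_left x.
have [] := survival_moments e01 bm bv n; rewrite !sum_rev => S1 S2.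
split; first exact: (expectation_hitting_time walk S1).
apply: (variance_hitting_time walk S1 S2).
apply: sumr_ge0 => k _; apply: le_trans (cross_mean_le_lim e01 bm 0 k%:Z).
exact: cross_mean_ge0.
Qed.

End quenched_moments.

Theorem theorem1p7 (R : realType)
  (* the environment *)
  (d : measure_display) (Omega : measurableType d) (P : probability Omega R)
  (omega : int -> {RV P >-> R})
  (omega_iid : iid omega)
  (omega01 : forall (i : int) (w : Omega), 0 < omega i w < 1)
  (* the quenched laws and the walk *)
  (d' : measure_display) (T : measurableType d')
  (Pq : (int -> R) -> probability T R) (X : nat -> T -> int)
  (walk : forall e : int -> R, (forall i, 0 < e i < 1) ->
     walk_in_environment (Pq e) X e)
  (* the assumptions on rho_0 *)
  (Elnrho : ('E_P[fun w => ln (rho (omega ^~ w) 0%R)] < 0)%E)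
  (kappa : R)
  (kappa_unique :
     unique (kappa_condition P (fun w => rho (omega ^~ w) 0)) kappa) :
  {ae P, forall w,
     (lne (expectatione (Pq (omega ^~ w)) (hitting_time R X n))
        / (ln (n%:R : R))%:E)%E @[n --> \oo]
       --> (Num.max (1 / kappa) 1)%:E} /\
  {ae P, forall w,
     (lne (variancee (Pq (omega ^~ w)) (hitting_time R X n))
        / (ln (n%:R : R))%:E)%E @[n --> \oo]
       --> (Num.max (2 / kappa) 1)%:E}.
Proof.
case: kappa_unique => -[kappa_gt0 kappa_moment _] _.
have {}kappa_moment : rho_moment omega kappa = 1%E.
  by move: kappa_moment; rewrite unlock.
(* One null set serves both limits; once the environment is named [e], the remaining argument is
   deterministic. *)
have H : {ae P, forall w, forall e, e = omega ^~ w ->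
    (lne (expectatione (Pq e) (hitting_time R X n))
       / (ln (n%:R : R))%:E)%E @[n --> \oo] --> (Num.max (1 / kappa) 1)%:E /\
    (lne (variancee (Pq e) (hitting_time R X n))
       / (ln (n%:R : R))%:E)%E @[n --> \oo] --> (Num.max (2 / kappa) 1)%:E}.
  have := sum_cross_mean_upper omega_iid omega01 Elnrho kappa_gt0 kappa_moment.
  have := sum_cross_var_upper omega_iid omega01 Elnrho kappa_gt0 kappa_moment.
  have := block_lower omega_iid omega01 Elnrho kappa_gt0 kappa_moment.
  have /filterI/[apply] := rho_sum_lower omega_iid omega01.
  apply: filterS3 => w [rhoL blockL] varU meanU e eE.
  rewrite -eE in rhoL varU meanU.
  have e01 i : 0 < e i < 1 by rewrite eE; exact: omega01.
  have bound (f : nat -> int -> R) theta : (forall j x, 0 <= f j x) ->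
      (forall delta, 0 < delta -> exists C, forall n j, (0 < n)%N ->
        \sum_(k < n) f j k%:Z <= C * n%:R `^ (theta + delta)) ->
      forall k : nat, exists C, forall j, f j k%:Z <= C.
    move=> f0 /(_ 1 ltr01) [C HC] k.
    exists (C * k.+1%:R `^ (theta + 1)) => j; apply: le_trans (HC k.+1 j isT).
    by rewrite big_ord_recr /= lerDr sumr_ge0.
  have bm := bound _ _ (cross_mean_ge0 e01) meanU.
  have bv := bound _ _ (cross_var_ge0 e01) varU.
  have EV := quenched_mean_var e01 (walk e e01) bm bv.
  have bm' x : exists C, forall j, cross_mean e j x <= C.
    by have [] := cross_bounded_left e01 bm bv x.
  have bv' x : exists C, forall j, cross_var e j x <= C.
    by have [] := cross_bounded_left e01 bm bv x.
  split.
    rewrite (_ : (fun n => _) = fun n =>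
      (lne (\sum_(k < n) mean_lim e k%:Z)%:E / (ln n%:R)%:E)%E); last first.
      by apply/funext => n; have [-> _] := EV n.
    apply: ln_ratio_cvg.
      move=> delta d0; have [C HC] := meanU delta d0; exists C => n n0.
      have cv : (fun j => \sum_(k < n) cross_mean e j k%:Z) @ \oo -->
          \sum_(k < n) mean_lim e k%:Z.
        apply: cvg_big => [|k _]; first exact: add_continuous.
        exact: cross_mean_cvg.
      rewrite -(cvg_lim (@Rhausdorff R) cv); apply: limr_le.
        by apply/cvg_ex; eexists; exact: cv.
      by apply: nearW => j; exact: HC.
    (* When 1 attains the maximum, each of the [n] crossings takes at least one unit of time;
       otherwise a single site at the end of a large block dominates. *)
    move=> delta d0; have [ik|ki] := leP (1 / kappa) 1.
      exists 1, 1%N; split=> // n n0; rewrite mul1r.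
      apply: (@le_trans _ _ (\sum_(k < n) 1)).
        rewrite sumr_const card_ord -[leRHS]powRr1 ?ler0n// ler_powR ?ler1n//; lra.
      apply: ler_sum => k _; apply: le_trans (cross_mean_le_lim e01 bm' 1 k%:Z).
      exact: cross_mean_ge1.
    have [c [n0 [c0 Hc]]] := blockL delta d0; exists c, n0; split=> // n n0n.
    have [k [m [kn m0 ckm]]] := Hc n n0n; apply: le_trans ckm _.
    case: m m0 => // m _.
    apply: (@le_trans _ _ (mean_lim e k%:Z)).
      apply: le_trans (cross_mean_le_lim e01 bm' m.+1 k%:Z).
      by rewrite eE; apply: cross_mean_ge_prod => i; exact: omega01.
    rewrite (bigD1 (Ordinal kn))//= lerDl; apply: sumr_ge0 => i _.
    by apply: le_trans (cross_mean_le_lim e01 bm' 0 i%:Z); exact: cross_mean_ge0.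
  rewrite (_ : (fun n => _) = fun n =>
    (lne (\sum_(k < n) var_lim e k%:Z)%:E / (ln n%:R)%:E)%E); last first.
    by apply/funext => n; have [_ ->] := EV n.
  have var0 x : 0 <= var_lim e x.
    by apply: le_trans (cross_var_le_lim e01 bv' 0 x); exact: cross_var_ge0.
  apply: ln_ratio_cvg.
    move=> delta d0; have [C HC] := varU delta d0; exists C => n n0.
    have cv : (fun j => \sum_(k < n) cross_var e j k%:Z) @ \oo -->
        \sum_(k < n) var_lim e k%:Z.
      apply: cvg_big => [|k _]; first exact: add_continuous.
      exact: cross_var_cvg.
    rewrite -(cvg_lim (@Rhausdorff R) cv); apply: limr_le.
      by apply/cvg_ex; eexists; exact: cv.
    by apply: nearW => j; exact: HC.
  move=> delta d0; have [ik|ki] := leP (2 / kappa) 1.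
    have [c [C [c0 Hc]]] := rhoL.
    (* Half of the slope [c] absorbs the additive constant [C] for large [n]. *)
    exists (c / 2), (Num.bound (`|C| / (c / 2))).+1; split; first by rewrite divr_gt0.
    move=> n n0; have n1 : (0 < n)%N by exact: leq_trans n0.
    have Cn : `|C| <= c / 2 * n%:R.
      rewrite mulrC -ler_pdivrMr ?divr_gt0//.
      apply: le_trans (ltW (archi_boundP _)) _; first by rewrite !divr_ge0// ltW.
      by rewrite ler_nat ltnW.
    apply: (@le_trans _ _ (c / 2 * n%:R)).
      rewrite ler_wpM2l ?divr_ge0 ?(ltW c0)// -[leRHS]powRr1 ?ler0n// ler_powR ?ler1n//; lra.
    apply: (@le_trans _ _ (\sum_(k < n) rho e k%:Z)).
      by have := Hc n; have := ler_norm C; move: Cn; lra.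
    apply: ler_sum => k _; apply: le_trans (cross_var_le_lim e01 bv' 1 k%:Z).
    exact: cross_var_ge_rho.
  (* The block product enters the variance squared, which doubles the loss in the exponent. *)
  have d2 : 0 < delta / 2 by rewrite divr_gt0.
  have [c [n0 [c0 Hc]]] := blockL _ d2; exists (c ^+ 2), n0; split=> [|n n0n].
    by rewrite exprn_gt0.
  have [k [m [kn m0 ckm]]] := Hc n n0n.
  case: m m0 ckm => // m _ ckm.
  apply: (@le_trans _ _ (var_lim e k%:Z)); last first.
    by rewrite (bigD1 (Ordinal kn))//= lerDl; apply: sumr_ge0.
  apply: le_trans (cross_var_le_lim e01 bv' m.+1 k%:Z).
  apply: le_trans (cross_var_ge_prod e01 m k%:Z).
  have -> : c ^+ 2 * n%:R `^ (2 / kappa - delta) = (c * n%:R `^ (1 / kappa - delta / 2)) ^+ 2.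
    rewrite exprMn -(powR_mulrn 2 (powR_ge0 _ _)) -powRrM; congr (_ * _ `^ _).
    by field; rewrite gt_eqF.
  apply: lerXn2r; rewrite ?nnegrE.
  - by rewrite mulr_ge0 ?powR_ge0// ltW.
  - by apply: prodr_ge0 => i _; exact/ltW/rho_gt0.
  - by apply: le_trans ckm _; rewrite /block_prod eE.
by split; apply: filterS H => w /(_ _ erefl) [].
Qed.
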